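(* Let $A\in\mathbb{R}^{n\times n}$ be symmetric positive definite and $X=A^{1/2}$. Let $\gamma_m=\frac{m\boldsymbol{u}}{1-m\boldsymbol{u}}$, $\gamma^l_{m}=\frac{m\boldsymbol{u}_l}{1-m\boldsymbol{u}_l}$ (for real $m>0$) and $\gamma_{\mathsf{eig}}=\frac{cn^2\boldsymbol{u}_l}{1-cn^2\boldsymbol{u}_l}$, where $\boldsymbol{u}$ and $\boldsymbol{u}_l$ are the unit roundoffs of the working and the lower precision and $c$ is the constant in the error bound for the spectral decomposition (see context). Let $\hat X_0$, $\{\hat X_k\}$, $\hat Q$, $\hat S$ be the quantities computed by the mixed precision algorithm described in the context, let $\tilde X_0=\hat Q\hat S\hat Q^{\top}$ (exact product), and let $B_{\tilde X_0}=I_n\otimes\tilde X_0+\tilde X_0^{\top}\otimes I_n$. Assume that the matrices $\{\hat X_k\}$ returned in each iterative refinement step are bounded, i.e. $M=\sup_{k\ge0}\|\hat X_k\|_{\mathsf F}/\|X\|_{\mathsf F}<+\infty$, and define $$\epsilon:=4\gamma_{n+1}(1+M^2)\,\|B_{\tilde X_0}^{-1}\|_2\,\|X\|_{\mathsf F}+\gamma_1M,\qquad \epsilon_l=\gamma^l_{n^{1/2}(4n+3)}+4\gamma_{\mathsf{eig}}\cdot\kappa_2(B_{\tilde X_0}).$$ If $$n^{1/2}\gamma_{\mathsf{eig}}\,\|A^{-1}\|_2\|A\|_{\mathsf F}\le\frac1{52},\qquad \epsilon_l\,\|A^{-1/2}\|_2\|A^{1/2}\|_{\mathsf F}\le\frac1{12},\qquad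 \epsilon\,\|A^{-1/2}\|_2\|A^{1/2}\|_{\mathsf F}<\frac3{32},$$ then $\{\hat X_k\}$ converges, up to the limiting accuracy $4\epsilon$, to the principal square root $X$ at least linearly. Specifically, there exist constants $\alpha\ge0$ and $0\le\rho<1$ (independent of $k$) such that for all $k\ge0$ $$\frac{\|X-\hat X_k\|_{\mathsf F}}{\|X\|_{\mathsf F}}\le4\epsilon+\alpha\rho^k .$$
   Context: $\|\cdot\|_2$ is the spectral norm, $\|\cdot\|_{\mathsf F}$ the Frobenius norm, $\kappa_2(M)=\|M\|_2\|M^{-1}\|_2$ for a matrix $M$, $\otimes$ is the Kronecker product, and $A^{1/2}$ is the symmetric positive definite (principal) square root, $A^{-1/2}=(A^{1/2})^{-1}$. Floating-point model: $\mathrm{fl}(\cdot)$ and $\mathrm{fl}_l(\cdot)$ denote computed values in working precision (unit roundoff $\boldsymbol{u}$) and lower precision (unit roundoff $\boldsymbol{u}_l$), respectively. Under the standard (Wilkinson) model every elementary operation ($+,-,\times,/,\sqrt{\cdot}$), and every conversion to the precision in question, has computed value equal to the exact value times $(1+\delta)$ with $|\delta|$ at most the unit roundoff (no overflow or underflow). Matrix products are computed by conventional inner products. All quantities $\gamma_m$, $\gamma^l_m$, $\gamma_{\mathsf{eig}}$ that occur are tacitly assumed well defined, i.e. their denominators are positive. Mixed precision algorithm for symmetric positive definite $A$ (run without stopping criterion): (1) Compute a spectral decomposition $A=QTQ^{\top}$ in lower precision. It is assumed that the computed factor $\hat Q\in\mathbb{R}^{n\times n}$ and the computed diagonal factor $\hat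 T$ satisfy $A+E=\hat Q\hat T\hat Q^{\top}$, where $\|\hat Q^{\top}\hat Q-I_n\|_2\le\gamma_{\mathsf{eig}}$, $E$ is symmetric and $\|E\|_2\le\gamma_{\mathsf{eig}}\|A\|_2$; here $c>0$ in $\gamma_{\mathsf{eig}}$ is a constant independent of $n$, $\boldsymbol{u}_l$ and $A$. (2) Compute the diagonal matrix $\hat S$ with entries $\hat s_{i,i}=\mathrm{fl}_l(\hat t_{i,i}^{1/2})$. (3) Compute $\hat X_0=\mathrm{fl}_l(\hat Q\hat S\hat Q^{\top})$. (4) For $k=0,1,2,\dots$: compute the residual $\hat P_k=\mathrm{fl}(A-\hat X_k^2)$ in working precision; convert it to lower precision, $\hat R_k=\mathrm{fl}_l(\hat P_k)$; compute $C=\mathrm{fl}_l(\hat Q^{\top}\hat R_k\hat Q)$ in lower precision; solve the diagonal Sylvester equation $\hat SY+Y\hat S=C$ in lower precision by computing $y_{i,j}=c_{i,j}/(\hat s_{i,i}+\hat s_{j,j})$, giving the computed matrix $\hat Y_k$; compute $\Delta\hat X_k=\mathrm{fl}_l(\hat Q\hat Y_k\hat Q^{\top})$ in lower precision; and update $\hat X_{k+1}=\mathrm{fl}(\hat X_k+\Delta\hat X_k)$ in working precision. *)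

(* Defs.v *)
From mathcomp Require Export all_boot all_order all_algebra.
From mathcomp Require Export classical_sets reals.
From mathcomp.real_closed Require Export mxtens.

Set Implicit Arguments.
Unset Strict Implicit.
Unset Printing Implicit Defensive.

Import Order.TTheory GRing.Theory Num.Theory.
Local Open Scope ring_scope.

(* On column vectors this is the Euclidean norm. *)
Definition normF (R : realType) (m n : nat) (A : 'M[R]_(m, n)) : R :=
  Num.sqrt (\sum_i \sum_j A i j ^+ 2).

(* Operator norm induced by the Euclidean norm. *)
Definition norm2 (R : realType) (m n : nat) (A : 'M[R]_(m, n)) : R :=
  sup [set normF (A *m x) | x in [set x : 'cV[R]_n | normF x <= 1]]%classic.

Definition kappa2 (R : realType) (n : nat) (A : 'M[R]_n) : R :=
  norm2 A * norm2 (invmx A).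

Definition spd (R : realType) (n : nat) (A : 'M[R]_n) : Prop :=
  A^T = A /\ forall x : 'cV[R]_n, x != 0 -> 0 < (x^T *m A *m x) 0 0.

Definition principal_sqrt (R : realType) (n : nat) (A X : 'M[R]_n) : Prop :=
  spd X /\ X *m X = A.

Definition kron_sum (R : realType) (n : nat) (X : 'M[R]_n) : 'M[R]_(n * n) :=
  (1%:M : 'M[R]_n) *t X + X^T *t (1%:M : 'M[R]_n).

Definition gam (R : realType) (u m : R) : R := m * u / (1 - m * u).

Definition gam_eig (R : realType) (ul c : R) (n : nat) : R :=
  gam ul (c * n%:R ^+ 2).

(* Rounding is a relation: [fl u x y] says that y is an admissible computed
   value, at unit roundoff u, of an operation whose exact result is x. *)
Definition fl (R : realType) (u x y : R) : Prop :=
  exists2 d : R, `|d| <= u & y = x * (1 + d).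

Definition fl_mx (R : realType) (m n : nat) (u : R) (A B : 'M[R]_(m, n)) :
  Prop := forall i j, fl u (A i j) (B i j).

(* [fl_sum u x I s]: s is a computed value of the sum of the x i for i in I,
   obtained by #|I| - 1 rounded additions carried out in some order. *)
Inductive fl_sum (R : realType) (n : nat) (u : R) (x : 'I_n -> R) :
    {set 'I_n} -> R -> Prop :=
| fl_sum_term (i : 'I_n) : fl_sum u x [set i]%SET (x i)
| fl_sum_add (I J : {set 'I_n}) (a b s : R) :
    [disjoint I & J] -> fl_sum u x I a -> fl_sum u x J b ->
    fl u (a + b) s -> fl_sum u x (I :|: J)%SET s.

Definition fl_dot (R : realType) (n : nat) (u : R) (x y : 'I_n -> R) (s : R) :
    Prop :=
  exists2 p : 'I_n -> R, (forall k, fl u (x k * y k) (p k)) &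
    fl_sum u p [set: 'I_n]%SET s.

Definition fl_mulmx (R : realType) (m n p : nat) (u : R)
    (A : 'M[R]_(m, n)) (B : 'M[R]_(n, p)) (C : 'M[R]_(m, p)) : Prop :=
  forall i j, fl_dot u (fun k => A i k) (fun k => B k j) (C i j).

(* A product of three matrices may be associated either way. *)
Definition fl_mulmx3 (R : realType) (n : nat) (u : R) (A B C D : 'M[R]_n) :
    Prop :=
  (exists2 W, fl_mulmx u A B W & fl_mulmx u W C D) \/
  (exists2 W, fl_mulmx u B C W & fl_mulmx u A W D).

(* Q and the diagonal matrix of t satisfy the error bounds, at level g, assumed
   of a computed spectral decomposition of A. *)
Definition computed_spectral (R : realType) (n : nat) (g : R)
    (A Q : 'M[R]_n) (t : 'rV[R]_n) : Prop :=
  norm2 (Q^T *m Q - 1%:M) <= g /\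
  exists E : 'M[R]_n,
    [/\ E^T = E, norm2 E <= g * norm2 A & A + E = Q *m diag_mx t *m Q^T].

Definition computed_residual (R : realType) (n : nat) (u : R)
    (A X P : 'M[R]_n) : Prop :=
  exists2 W, fl_mulmx u X X W & fl_mx u (A - W) P.

Definition computed_sylvester (R : realType) (n : nat) (u : R)
    (s : 'rV[R]_n) (C Y : 'M[R]_n) : Prop :=
  forall i j, exists2 d : R, fl u (s 0 i + s 0 j) d & fl u (C i j / d) (Y i j).

Definition refinement_step (R : realType) (n : nat) (u ul : R)
    (A Q : 'M[R]_n) (s : 'rV[R]_n) (X X' : 'M[R]_n) : Prop :=
  exists P Rl C Y DX : 'M[R]_n,
    [/\ computed_residual u A X P, fl_mx ul P Rl & fl_mulmx3 ul Q^T Rl Q C] /\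
    [/\ computed_sylvester ul s C Y, fl_mulmx3 ul Q Y Q^T DX &
        fl_mx u (X + DX) X'].

(* g bounds the errors of the spectral decomposition; s is the diagonal of the
   matrix S of the algorithm. *)
Record mixed_precision_run (R : realType) (n : nat) (u ul g : R)
    (A Q : 'M[R]_n) (t s : 'rV[R]_n) (X : nat -> 'M[R]_n) : Prop :=
  MixedPrecisionRun {
    run_spectral : computed_spectral g A Q t;
    run_sqrt : forall i, fl ul (Num.sqrt (t 0 i)) (s 0 i);
    run_init : fl_mulmx3 ul Q (diag_mx s) Q^T (X 0%N);
    run_step : forall k, refinement_step u ul A Q s (X k) (X k.+1) }.

(* Meaningful only when the norms of the Xk are bounded. *)
Definition iterate_bound (R : realType) (n : nat) (X : 'M[R]_n)
    (Xk : nat -> 'M[R]_n) : R :=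
  sup (range (fun k => normF (Xk k) / normF X))%classic.

Definition limiting_accuracy (R : realType) (n : nat) (u M : R)
    (X Xt : 'M[R]_n) : R :=
  4 * gam u n.+1%:R * (1 + M ^+ 2) * norm2 (invmx (kron_sum Xt)) * normF X
  + gam u 1 * M.

Definition eps_low (R : realType) (n : nat) (ul c : R) (Xt : 'M[R]_n) : R :=
  gam ul (Num.sqrt n%:R * (4 * n + 3)%:R)
  + 4 * gam_eig ul c n * kappa2 (kron_sum Xt).

(* Main.v *)
Require Import Defs.
From mathcomp Require Import ring lra zify.

Set Implicit Arguments.
Unset Strict Implicit.
Unset Printing Implicit Defensive.

Import Order.TTheory GRing.Theory Num.Theory.
Local Open Scope ring_scope.

(** Write [N] for the Frobenius norm of [X], [L] for the spectral norm of its
    inverse, [g] for the level of the spectral error bounds, [M] for the bound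
    on the iterates and [Xt = Q S Q^T].  All errors are measured by
    [normF (X - Xk k) * L], which the hypotheses keep at most 3/8.

    The factors.  Since [Q^T Q] is within [g] of the identity, the quadratic form
    of [A + E = Q T Q^T] confines the entries of [T], hence those of [S]: they
    are at least [24/25 / L], and [g] times any of them is at most [1/50 / L]
    ([spectral_bounds], [s_lower], [gs_upper]).  The square root of [Q T Q^T] is
    nearly [X' = Q T^(1/2) Q^T], and
    [X' (X' - X) + (X' - X) X = X' X' - A] is a Sylvester equation whose
    coefficients are positive semidefinite and positive definite; testing it
    against [X' - X] bounds [X' - X] ([sylvester_coercive],
    [sqrt_perturbation]).  Hence [Xt] lies within [1/16 / L] of [X] and the first
    iterate within [3/8 / L] ([init_perturbation], [initial_iterate_err]).

    The step.  With [e = X - Y] and [f] such that [e = Q f Q^T], the exact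
    correction [Q (sylv s (Q^T (A - Y Y) Q)) Q^T] differs from [e] by the image
    of a right-hand side which is small for two reasons: [Q^T Q] is near the
    identity and [Xt] is near [X].  The remainder is a small multiple of [e] plus
    a term quadratic in [e] ([exact_correction_err]).  The low precision roundoffs
    only add a relative error [gam ul (sqrt n * (4 n + 3))] of the correction
    ([correction_err], [low_precision_factor]), while the working precision
    roundoffs give the additive term of the limiting accuracy; there the inverse
    of the Kronecker sum enters through [cond_le_kron_inv], which bounds [L] by
    17/8 of its spectral norm.  Altogether one step halves the error, up to
    [eps * (N * L)] ([refinement_contraction]), so that the iterates reach
    [2 * eps] at rate 1/2. *)

(** * The Frobenius norm *)

Section FrobeniusNorm.
Variable R : realType.

Lemma ler_eq (x y : R) : x = y -> x <= y.
Proof. by move=> ->. Qed.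

Lemma CauchySchwarz_sum (I : finType) (x y : I -> R) :
  (\sum_i x i * y i) ^+ 2 <= (\sum_i x i ^+ 2) * (\sum_i y i ^+ 2).
Proof.
have expand (b c : R) : \sum_i (b * x i - c * y i) ^+ 2 =
    b ^+ 2 * (\sum_i x i ^+ 2) - 2 * b * c * (\sum_i x i * y i)
      + c ^+ 2 * (\sum_i y i ^+ 2).
  by rewrite !mulr_sumr -sumrB -big_split /=; apply: eq_bigr => i _; ring.
set a := \sum_i x i ^+ 2; set b := \sum_i y i ^+ 2; set c := \sum_i x i * y i.
have key : b * (a * b - c ^+ 2) = \sum_i (b * x i - c * y i) ^+ 2.
  by rewrite expand -/a -/b -/c; ring.
have b0 : 0 <= b by apply: sumr_ge0 => i _; exact: sqr_ge0.
have := b0; rewrite le_eqVlt => /orP[/eqP b_eq0|b_gt0].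
  have y0 i : y i = 0.
    apply/eqP; rewrite -sqrf_eq0; apply/eqP.
    exact: (psumr_eq0P (fun i _ => sqr_ge0 (y i)) (esym b_eq0)).
  by rewrite /c big1 ?expr0n ?mulr0 -?b_eq0 ?mulr0 // => i _; rewrite y0 mulr0.
rewrite -subr_ge0 -(pmulr_rge0 _ b_gt0) key.
by apply: sumr_ge0 => i _; exact: sqr_ge0.
Qed.

(** The Frobenius inner product. *)
Definition dotF m n (A B : 'M[R]_(m, n)) : R := \sum_i \sum_j A i j * B i j.

Lemma dotFE m n (A B : 'M[R]_(m, n)) : dotF A B = \tr (A^T *m B).
Proof.
rewrite /mxtrace /dotF exchange_big; apply: eq_bigr => j _.
by rewrite mxE; apply: eq_bigr => i _; rewrite mxE.
Qed.

Lemma dotFC m n (A B : 'M[R]_(m, n)) : dotF A B = dotF B A.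
Proof. by apply: eq_bigr => i _; apply: eq_bigr => j _; rewrite mulrC. Qed.

Lemma dotFDr m n (A B C : 'M[R]_(m, n)) : dotF A (B + C) = dotF A B + dotF A C.
Proof. by rewrite !dotFE mulmxDr mxtraceD. Qed.

Lemma dotFZr m n a (A B : 'M[R]_(m, n)) : dotF A (a *: B) = a * dotF A B.
Proof. by rewrite !dotFE -scalemxAr mxtraceZ. Qed.

Lemma dotF_tr m n (A B : 'M[R]_(m, n)) : dotF A^T B^T = dotF A B.
Proof.
by rewrite /dotF exchange_big; do 2![apply: eq_bigr => ? _]; rewrite !mxE.
Qed.

Lemma normF_ge0 m n (A : 'M[R]_(m, n)) : 0 <= normF A.
Proof. exact: sqrtr_ge0. Qed.

Lemma sqr_normF m n (A : 'M[R]_(m, n)) : normF A ^+ 2 = \sum_i \sum_j A i j ^+ 2.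
Proof.
by rewrite sqr_sqrtr //; do 2![apply: sumr_ge0 => ? _]; exact: sqr_ge0.
Qed.

Lemma dotFF m n (A : 'M[R]_(m, n)) : dotF A A = normF A ^+ 2.
Proof. by rewrite sqr_normF; do 2![apply: eq_bigr => ? _]; rewrite expr2. Qed.

Lemma normF_le_sqr m n (A : 'M[R]_(m, n)) (a : R) :
  0 <= a -> normF A ^+ 2 <= a ^+ 2 -> normF A <= a.
Proof. by move=> a0; rewrite ler_sqr // nnegrE normF_ge0. Qed.

Lemma dotF_le m n (A B : 'M[R]_(m, n)) : `|dotF A B| <= normF A * normF B.
Proof.
rewrite -ler_sqr ?nnegrE ?mulr_ge0 ?normF_ge0 // exprMn real_normK ?num_real //.
rewrite !sqr_normF /dotF !pair_bigA /=.
exact: (CauchySchwarz_sum (fun p => A p.1 p.2)).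
Qed.

Lemma normF0 m n : normF (0 : 'M[R]_(m, n)) = 0.
Proof.
by rewrite /normF big1 ?sqrtr0 // => i _; rewrite big1 // => j _; rewrite mxE expr0n.
Qed.

Lemma normF_eq0 m n (A : 'M[R]_(m, n)) : normF A = 0 -> A = 0.
Proof.
move=> A0; have := sqr_normF A; rewrite A0 expr0n /= pair_bigA /= => /esym S0.
apply/matrixP => i j; rewrite mxE; apply/eqP; rewrite -sqrf_eq0; apply/eqP.
by apply: (psumr_eq0P _ S0 (i := (i, j))) => // p _; exact: sqr_ge0.
Qed.

Lemma normF_gt0 m n (A : 'M[R]_(m, n)) : A != 0 -> 0 < normF A.
Proof.
by move=> A0; rewrite lt_def normF_ge0 andbT; apply: contra_neq A0 => /normF_eq0.
Qed.

Lemma normF_tr m n (A : 'M[R]_(m, n)) : normF A^T = normF A.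
Proof.
rewrite /normF exchange_big; congr Num.sqrt.
by do 2![apply: eq_bigr => ? _]; rewrite mxE.
Qed.

Lemma normFZ m n a (A : 'M[R]_(m, n)) : normF (a *: A) = `|a| * normF A.
Proof.
rewrite /normF -sqrtr_sqr -sqrtrM ?sqr_ge0 // mulr_sumr; congr Num.sqrt.
apply: eq_bigr => i _; rewrite mulr_sumr; apply: eq_bigr => j _.
by rewrite mxE exprMn.
Qed.

Lemma normFN m n (A : 'M[R]_(m, n)) : normF (- A) = normF A.
Proof. by rewrite -scaleN1r normFZ normrN1 mul1r. Qed.

Lemma ler_normFD m n (A B : 'M[R]_(m, n)) : normF (A + B) <= normF A + normF B.
Proof.
apply: normF_le_sqr; first by rewrite addr_ge0 ?normF_ge0.
rewrite -dotFF dotFDr dotFC dotFDr (dotFC (A + B)) dotFDr !dotFF.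
have := le_trans (ler_norm _) (dotF_le A B); rewrite (dotFC B A); lra.
Qed.

Lemma ler_normFB m n (A B : 'M[R]_(m, n)) : normF (A - B) <= normF A + normF B.
Proof. by rewrite -(normFN B) ler_normFD. Qed.

Lemma normFB_sym m n (A B : 'M[R]_(m, n)) : normF (A - B) = normF (B - A).
Proof. by rewrite -opprB normFN. Qed.

Lemma normF_le_entries m n (A B : 'M[R]_(m, n)) :
  (forall i j, `|A i j| <= B i j) -> normF A <= normF B.
Proof.
move=> AB; rewrite ler_wsqrtr //; do 2![apply: ler_sum => ? _].
by rewrite -real_normK ?num_real // ler_sqr ?nnegrE // (le_trans _ (AB _ _)).
Qed.

Lemma normF_abs m n (A : 'M[R]_(m, n)) : normF (map_mx Num.norm A) = normF A.
Proof.
rewrite /normF; congr Num.sqrt; do 2![apply: eq_bigr => ? _].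
by rewrite mxE real_normK ?num_real.
Qed.

Lemma normFM m n p (A : 'M[R]_(m, n)) (B : 'M[R]_(n, p)) :
  normF (A *m B) <= normF A * normF B.
Proof.
apply: normF_le_sqr; first by rewrite mulr_ge0 ?normF_ge0.
rewrite exprMn !sqr_normF mulr_suml; apply: ler_sum => i _.
rewrite [X in _ * X]exchange_big mulr_sumr; apply: ler_sum => j _.
by rewrite mxE; exact: CauchySchwarz_sum.
Qed.

Lemma normF_1 n : normF (1%:M : 'M[R]_n) = Num.sqrt n%:R.
Proof.
rewrite /normF; congr Num.sqrt.
rewrite (eq_bigr (fun=> 1)) ?sumr_const ?card_ord // => i _.
rewrite (bigD1 i) //= big1 ?addr0 => [|j ji]; first by rewrite mxE eqxx expr1n.
by rewrite mxE eq_sym (negPf ji) expr0n.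
Qed.

Lemma normF_delta n (i : 'I_n) : normF (delta_mx i 0 : 'cV[R]_n) = 1.
Proof.
rewrite /normF (bigD1 i) //= big_ord1 mxE !eqxx expr1n big1 ?addr0 ?sqrtr1 // => j ji.
by rewrite big_ord1 mxE (negPf ji) expr0n.
Qed.

Lemma normF_tens (m n : nat) (x : 'cV[R]_m) (y : 'cV[R]_n) :
  normF (x *t y : 'cV[R]_(m * n)) = normF x * normF y.
Proof.
rewrite /normF -sqrtrM; last by do 2![apply: sumr_ge0 => ? _]; exact: sqr_ge0.
congr Num.sqrt; rewrite mulr_suml.
rewrite (reindex (fun p => mxtens_index p)) /=; last first.
  by apply: onW_bij; exists (@mxtens_unindex m n);
     [exact: mxtens_indexK | exact: mxtens_unindexK].
transitivity (\sum_(i < m) \sum_(j < n)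
    (x *t y : 'cV[R]_(m * n)) (mxtens_index (i, j)) 0 ^+ 2).
  by rewrite [RHS]pair_bigA /=; apply: eq_bigr => -[i j] _; rewrite big_ord1.
apply: eq_bigr => i _; rewrite big_ord1 mulr_sumr; apply: eq_bigr => j _.
by rewrite big_ord1 mxE mxtens_indexK /= exprMn !(ord1 (Ordinal _)).
Qed.

Lemma normF_le_scale m n (A B : 'M[R]_(m, n)) a : 0 <= a ->
  (forall i j, `|A i j| <= a * `|B i j|) -> normF A <= a * normF B.
Proof.
move=> a0 AB; rewrite -(normF_abs B) -[a in leRHS]ger0_norm // -normFZ.
by apply: normF_le_entries => i j; rewrite !mxE.
Qed.

End FrobeniusNorm.

(** * The spectral norm and quadratic forms *)

Section SpectralNorm.
Variable R : realType.

(** [opbound A a]: the number [a] bounds the operator norm of [A]. *)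
Definition opbound m n (A : 'M[R]_(m, n)) (a : R) : Prop :=
  forall x : 'cV[R]_n, normF (A *m x) <= a * normF x.

Lemma norm2_has_sup m n (A : 'M[R]_(m, n)) :
  has_sup [set normF (A *m x) | x in [set x : 'cV[R]_n | normF x <= 1]]%classic.
Proof.
split; first by exists (normF (A *m (0 : 'cV[R]_n))); exists 0 => //=; rewrite normF0.
exists (normF A) => _ [x /= x1 <-]; apply: le_trans (normFM _ _) _.
by rewrite ler_piMr ?normF_ge0.
Qed.

Lemma norm2_ge0 m n (A : 'M[R]_(m, n)) : 0 <= norm2 A.
Proof.
have : normF (A *m (0 : 'cV[R]_n)) <= norm2 A.
  by apply: ub_le_sup; [case: (norm2_has_sup A) | exists 0; rewrite //= normF0].
by rewrite mulmx0 normF0.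
Qed.

Lemma norm2_opbound m n (A : 'M[R]_(m, n)) : opbound A (norm2 A).
Proof.
move=> x; have [-> | x0] := eqVneq x 0; first by rewrite mulmx0 !normF0 mulr0.
have nx := normF_gt0 x0.
rewrite -ler_pdivrMr // mulrC -[X in X * _]ger0_norm ?invr_ge0 ?(ltW nx) //.
rewrite -normFZ scalemxAr; apply: ub_le_sup; first by case: (norm2_has_sup A).
exists ((normF x)^-1 *: x) => //=.
by rewrite normFZ ger0_norm ?invr_ge0 ?mulVf ?gt_eqF // ltW.
Qed.

Lemma norm2_le m n (A : 'M[R]_(m, n)) a : 0 <= a -> opbound A a -> norm2 A <= a.
Proof.
move=> a0 Aa; apply: ge_sup; first by case: (norm2_has_sup A).
by move=> _ [x /= x1 <-]; apply: le_trans (Aa x) _; rewrite ler_piMr.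
Qed.

Lemma opbound_normF m n (A : 'M[R]_(m, n)) : opbound A (normF A).
Proof. by move=> x; exact: normFM. Qed.

Lemma opbound_le m n (A : 'M[R]_(m, n)) a b : opbound A a -> a <= b -> opbound A b.
Proof. by move=> Aa ab x; apply: le_trans (Aa x) _; rewrite ler_wpM2r ?normF_ge0. Qed.

Lemma norm2_le_normF m n (A : 'M[R]_(m, n)) : norm2 A <= normF A.
Proof. by apply: norm2_le; [exact: normF_ge0 | exact: opbound_normF]. Qed.

Lemma normF_col m n (A : 'M[R]_(m, n)) :
  normF A ^+ 2 = \sum_j normF (col j A) ^+ 2.
Proof.
rewrite sqr_normF exchange_big; apply: eq_bigr => j _; rewrite sqr_normF.
by apply: eq_bigr => i _; rewrite big_ord1 mxE.
Qed.

Lemma col_mulmx m n p (A : 'M[R]_(m, n)) (B : 'M[R]_(n, p)) j :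
  col j (A *m B) = A *m col j B.
Proof. by rewrite !colE mulmxA. Qed.

(** Frobenius norm of a product, one factor being measured as an operator. *)
Lemma normF_mull m n p (A : 'M[R]_(m, n)) a (B : 'M[R]_(n, p)) :
  0 <= a -> opbound A a -> normF (A *m B) <= a * normF B.
Proof.
move=> a0 Aa; apply: normF_le_sqr; first by rewrite mulr_ge0 ?normF_ge0.
rewrite exprMn !normF_col mulr_sumr; apply: ler_sum => j _.
rewrite col_mulmx -exprMn ler_sqr ?nnegrE ?mulr_ge0 ?normF_ge0 //; exact: Aa.
Qed.

Lemma normF_mulr m n p (A : 'M[R]_(n, p)) a (B : 'M[R]_(m, n)) :
  0 <= a -> opbound A^T a -> normF (B *m A) <= a * normF B.
Proof.
by move=> a0 Aa; rewrite -normF_tr trmx_mul -(normF_tr B); exact: normF_mull.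
Qed.

Lemma normF_le_sqrtn m n (A : 'M[R]_(m, n)) a :
  0 <= a -> opbound A a -> normF A <= Num.sqrt n%:R * a.
Proof.
by move=> a0 Aa; rewrite -{1}(mulmx1 A) -normF_1 mulrC; exact: normF_mull.
Qed.

(** The quadratic form of a square matrix. *)
Definition qform n (A : 'M[R]_n) (x : 'cV[R]_n) : R := (x^T *m A *m x) 0 0.

Lemma qformE n (A : 'M[R]_n) x : qform A x = dotF x (A *m x).
Proof. by rewrite /qform dotFE -mulmxA /mxtrace big_ord1. Qed.

Lemma qform_le n (A : 'M[R]_n) a x :
  opbound A a -> `|qform A x| <= a * normF x ^+ 2.
Proof.
move=> Aa; rewrite qformE; apply: le_trans (dotF_le _ _) _.
by rewrite expr2 mulrCA ler_wpM2l ?normF_ge0.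
Qed.

Lemma qformD n (A B : 'M[R]_n) x : qform (A + B) x = qform A x + qform B x.
Proof. by rewrite /qform mulmxDr mulmxDl mxE. Qed.

Lemma qformN n (A : 'M[R]_n) x : qform (- A) x = - qform A x.
Proof. by rewrite /qform mulmxN mulNmx mxE. Qed.

Lemma qform1 n (x : 'cV[R]_n) : qform 1%:M x = normF x ^+ 2.
Proof. by rewrite qformE mul1mx dotFF. Qed.

Lemma qform_gram m n (B : 'M[R]_(m, n)) x : qform (B^T *m B) x = normF (B *m x) ^+ 2.
Proof.
by rewrite -dotFF !qformE -[B^T *m B *m x]mulmxA !dotFE trmx_mul !mulmxA.
Qed.

Lemma qform_congr m n (A : 'M[R]_m) (B : 'M[R]_(m, n)) x :
  qform (B^T *m A *m B) x = qform A (B *m x).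
Proof. by rewrite /qform trmx_mul !mulmxA. Qed.

Lemma qform_diag n (d : 'rV[R]_n) x :
  qform (diag_mx d) x = \sum_i d 0 i * x i 0 ^+ 2.
Proof.
rewrite qformE /dotF; apply: eq_bigr => i _; rewrite big_ord1.
by rewrite mul_diag_mx mxE mulrCA expr2.
Qed.

(** [coercive A a]: the quadratic form of [A] is at least [a] times the square
    of the Euclidean norm. *)
Definition coercive n (A : 'M[R]_n) (a : R) : Prop :=
  forall x : 'cV[R]_n, a * normF x ^+ 2 <= qform A x.

Lemma coercive_normF n p (A : 'M[R]_n) a (B : 'M[R]_(n, p)) :
  coercive A a -> a * normF B ^+ 2 <= dotF B (A *m B).
Proof.
move=> Aa; rewrite normF_col mulr_sumr.
have -> : dotF B (A *m B) = \sum_j qform A (col j B).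
  rewrite /dotF exchange_big; apply: eq_bigr => j _; rewrite qformE /dotF.
  by apply: eq_bigr => i _; rewrite big_ord1 -col_mulmx !mxE.
by apply: ler_sum => j _; exact: Aa.
Qed.

(** The Sylvester operator [Z |-> P Z + Z M] inherits the sum of the coercivity
    constants: its inner product with [Z] splits into quadratic forms of the
    columns of [Z] and of its rows. *)
Lemma sylvester_coercive n (P M Z : 'M[R]_n) p m :
  coercive P p -> coercive M m -> M^T = M ->
  (p + m) * normF Z <= normF (P *m Z + Z *m M).
Proof.
move=> Pp Mm Msym; have [-> | Z0] := eqVneq Z 0.
  by rewrite mulmx0 mul0mx addr0 normF0 mulr0.
rewrite -(ler_pM2l (normF_gt0 Z0)).
apply: le_trans (le_trans (ler_norm _) (dotF_le _ _)).
rewrite dotFDr mulrCA -expr2 mulrDl lerD ?coercive_normF //.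
by rewrite -dotF_tr trmx_mul Msym -normF_tr coercive_normF.
Qed.

Lemma normF_congr n (A B C : 'M[R]_n) q : 0 <= q -> opbound A q -> opbound C^T q ->
  normF (A *m B *m C) <= q ^+ 2 * normF B.
Proof.
move=> q0 Aq Cq; apply: le_trans (normF_mulr _ q0 Cq) _.
by rewrite expr2 -mulrA ler_wpM2l // normF_mull.
Qed.

Lemma opbound_diag n (d : 'rV[R]_n) b : 0 <= b -> (forall i, `|d 0 i| <= b) ->
  opbound (diag_mx d) b.
Proof.
move=> b0 db x; apply: normF_le_scale => // i j.
by rewrite mul_diag_mx mxE normrM ler_wpM2r.
Qed.

Lemma opboundM m1 m2 m3 (B : 'M[R]_(m1, m2)) (C : 'M[R]_(m2, m3)) b c :
  0 <= b -> opbound B b -> opbound C c -> opbound (B *m C) (b * c).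
Proof.
move=> b0 Bb Cc x; rewrite -mulmxA; apply: le_trans (Bb _) _.
by rewrite -mulrA ler_wpM2l.
Qed.

End SpectralNorm.

(** * Rounding errors of sums and products *)

Section Rounding.
Variable R : realType.

(** Whatever the order of the additions, a term takes part in at most
    [#|I| - 1] of them. *)
Lemma fl_sum_err n (u : R) (x : 'I_n -> R) I s m : 0 <= u ->
  fl_sum u x I s -> (#|I| <= m.+1)%N ->
  `|s - \sum_(i in I) x i| <= ((1 + u) ^+ m - 1) * \sum_(i in I) `|x i|.
Proof.
move=> u0 H; elim: H m => [i m _|I' J a b s' dIJ Ia IHa Jb IHb [d du ->] m].
  rewrite !big_set1 subrr normr0 mulr_ge0 // subr_ge0 exprn_ege1 //; lra.
have gt0 K c : fl_sum u x K c -> (0 < #|K|)%N.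
  elim=> [i|K1 K2 ? ? ? _ _ K10 _ _ _]; first by rewrite cards1.
  by apply: leq_trans K10 _; rewrite subset_leq_card // finset.subsetUl.
have I0 := gt0 _ _ Ia; have J0 := gt0 _ _ Jb.
have -> : #|(I' :|: J)%SET| = (#|I'| + #|J|)%N.
  by apply/eqP; rewrite (leq_card_setU I' J).2.
case: m => [|m] Hm; first by lia.
have {}IHa := IHa m ltac:(lia); have {}IHb := IHb m ltac:(lia).
have sumU (F : 'I_n -> R) :
    \sum_(i in (I' :|: J)%SET) F i = \sum_(i in I') F i + \sum_(i in J) F i.
  by rewrite -bigU //; apply: eq_bigl => i; rewrite finset.in_setU.
rewrite !sumU exprS.
move: IHa IHb; set SI := \sum_(i in I') _; set SJ := \sum_(i in J) _.
set NI := \sum_(i in I') _; set NJ := \sum_(i in J) _; set e := _ ^+ m => ha hb.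
have nI : `|SI| <= NI by exact: ler_norm_sum.
have nJ : `|SJ| <= NJ by exact: ler_norm_sum.
have e1 : 1 <= e by rewrite exprn_ege1 //; lra.
have -> : (a + b) * (1 + d) - (SI + SJ) = (a - SI) + (b - SJ) + d * (a + b) by ring.
have na : `|a| <= e * NI.
  by have := ler_normD (a - SI) SI; rewrite subrK mulrBl mul1r in ha *; lra.
have nb : `|b| <= e * NJ.
  by have := ler_normD (b - SJ) SJ; rewrite subrK mulrBl mul1r in hb *; lra.
have nd : `|d * (a + b)| <= u * (e * NI + e * NJ).
  by rewrite normrM ler_pM // (le_trans (ler_normD _ _)) ?lerD.
apply: le_trans (ler_normD _ _) _; apply: le_trans (lerD (ler_normD _ _) nd) _.
apply: le_trans (lerD (lerD ha hb) (lexx _)) _; by apply: ler_eq; ring.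
Qed.

Lemma fl_dot_err n (u : R) (x y : 'I_n -> R) s : (0 < n)%N -> 0 <= u ->
  fl_dot u x y s ->
  `|s - \sum_k x k * y k| <= ((1 + u) ^+ n - 1) * \sum_k `|x k * y k|.
Proof.
case: n x y => // n x y _ u0 [p px ps].
have p_err k : `|p k - x k * y k| <= u * `|x k * y k|.
  have [d du ->] := px k.
  have -> : x k * y k * (1 + d) - x k * y k = d * (x k * y k) by ring.
  by rewrite normrM ler_wpM2r.
have p_le k : `|p k| <= (1 + u) * `|x k * y k|.
  by have := ler_normD (p k - x k * y k) (x k * y k);
     rewrite subrK; have := p_err k; lra.
have := fl_sum_err (m := n) u0 ps; rewrite cardsT card_ord => /(_ (leqnn _)).
have eqT (F : 'I_n.+1 -> R) : \sum_(i in [set: 'I_n.+1]%SET) F i = \sum_i F i.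
  by apply: eq_bigl => i; rewrite finset.in_setT.
rewrite !eqT => hs.
have hp : `|\sum_k p k - \sum_k x k * y k| <= u * \sum_k `|x k * y k|.
  rewrite -sumrB mulr_sumr; apply: le_trans (ler_norm_sum _ _ _) _.
  by apply: ler_sum => k _; exact: p_err.
have hn : \sum_k `|p k| <= (1 + u) * \sum_k `|x k * y k|.
  by rewrite mulr_sumr; apply: ler_sum => k _; exact: p_le.
have e1 : 1 <= (1 + u) ^+ n by rewrite exprn_ege1 //; lra.
have hm := ler_wpM2l (ltac:(lra) : 0 <= (1 + u) ^+ n - 1) hn.
rewrite -(subrKA (\sum_k p k)).
apply: le_trans (ler_normD _ _) _; rewrite addrC.
apply: le_trans (lerD hp (le_trans hs hm)) _.
by apply: ler_eq; rewrite exprS; ring.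
Qed.

Lemma fl_mulmx_entry m n p (u : R) (A : 'M[R]_(m, n)) (B : 'M[R]_(n, p)) C i j :
  (0 < n)%N -> 0 <= u -> fl_mulmx u A B C ->
  `|C i j - (A *m B) i j| <=
    ((1 + u) ^+ n - 1) * (map_mx Num.norm A *m map_mx Num.norm B) i j.
Proof.
move=> n0 u0 /(_ i j) /(fl_dot_err n0 u0); rewrite !mxE => /le_trans; apply.
rewrite ler_wpM2l //; first by rewrite subr_ge0 exprn_ege1 //; lra.
by apply: ler_sum => k _; rewrite !mxE normrM.
Qed.

Lemma fl_mulmx_err m n p (u : R) (A : 'M[R]_(m, n)) (B : 'M[R]_(n, p)) C :
  (0 < n)%N -> 0 <= u -> fl_mulmx u A B C ->
  normF (C - A *m B) <= ((1 + u) ^+ n - 1) * (normF A * normF B).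
Proof.
move=> n0 u0 AB.
have e0 : 0 <= (1 + u) ^+ n - 1 by rewrite subr_ge0 exprn_ege1 //; lra.
apply: le_trans (_ : normF (((1 + u) ^+ n - 1) *:
    (map_mx Num.norm A *m map_mx Num.norm B)) <= _).
  apply: normF_le_entries => i j; rewrite [leRHS]mxE.
  have -> : (C - A *m B) i j = C i j - (A *m B) i j.
    by rewrite [LHS]mxE [X in _ + X]mxE.
  exact: fl_mulmx_entry.
rewrite normFZ ger0_norm // ler_wpM2l // -(normF_abs A) -(normF_abs B).
exact: normFM.
Qed.

(** Normwise error of a computed triple product whose outer factors are bounded
    by [q] as operators and by [r * q] in the Frobenius norm.  Using the
    Frobenius norm of only one factor per product keeps the power of [r] equal to
    the number of products. *)
Lemma fl_mulmx3_err n (u q r : R) (A B C D : 'M[R]_n) :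
  (0 < n)%N -> 0 <= u -> 0 <= q -> 0 <= r ->
  opbound A q -> opbound C^T q -> normF A <= r * q -> normF C <= r * q ->
  fl_mulmx3 u A B C D ->
  normF (D - A *m B *m C) <=
    ((1 + ((1 + u) ^+ n - 1) * r) ^+ 2 - 1) * (q ^+ 2 * normF B).
Proof.
move=> n0 u0 q0 r0 Aq Cq Ar Cr.
set e := (1 + u) ^+ n - 1.
have e0 : 0 <= e by rewrite subr_ge0 exprn_ege1 //; lra.
have b0 := normF_ge0 B; have rq0 : 0 <= r * q by exact: mulr_ge0.
have fin (x : R) w : w <= (1 + e * r) * (q * normF B) ->
    x <= e * (w * (r * q)) + q * (e * (r * q * normF B)) ->
    x <= ((1 + e * r) ^+ 2 - 1) * (q ^+ 2 * normF B).
  move=> hw /le_trans; apply.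
  have h : e * (w * (r * q)) <= e * ((1 + e * r) * (q * normF B) * (r * q)).
    by rewrite ler_wpM2l // ler_wpM2r.
  by rewrite (le_trans (lerD h (lexx _))) //; apply: ler_eq; ring.
case=> [[W AB WC]|[W BC AW]].
  have h1 : normF (W - A *m B) <= e * (r * q * normF B).
    rewrite (le_trans (fl_mulmx_err n0 u0 AB)) // -/e ler_wpM2l // ler_wpM2r //.
  apply: (fin _ (normF W)).
    have := ler_normFD (W - A *m B) (A *m B); rewrite subrK => /le_trans; apply.
    have := normF_mull B q0 Aq; lra.
  rewrite -(subrKA (W *m C)) -mulmxBl; apply: le_trans (ler_normFD _ _) _.
  apply: lerD; last first.
    by apply: le_trans (normF_mulr _ q0 Cq) _; rewrite ler_wpM2l.
  rewrite (le_trans (fl_mulmx_err n0 u0 WC)) // -/e ler_wpM2l // ler_wpM2l //.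
  exact: normF_ge0.
have h1 : normF (W - B *m C) <= e * (r * q * normF B).
  rewrite (le_trans (fl_mulmx_err n0 u0 BC)) // -/e ler_wpM2l // mulrC ler_wpM2r //.
apply: (fin _ (normF W)).
  have := ler_normFD (W - B *m C) (B *m C); rewrite subrK => /le_trans; apply.
  have := normF_mulr B q0 Cq; lra.
rewrite -mulmxA -(subrKA (A *m W)) -mulmxBr; apply: le_trans (ler_normFD _ _) _.
apply: lerD; last first.
  by apply: le_trans (normF_mull _ q0 Aq) _; rewrite ler_wpM2l.
rewrite (le_trans (fl_mulmx_err n0 u0 AW)) // -/e ler_wpM2l // mulrC ler_wpM2l //.
exact: normF_ge0.
Qed.

Lemma expr1D_le n (u : R) : 0 <= u -> n%:R * u < 1 ->
  (1 + u) ^+ n <= (1 - n%:R * u)^-1.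
Proof.
move=> u0 nu.
suff h : (1 + u) ^+ n * (1 - n%:R * u) <= 1.
  by rewrite -[leRHS]mul1r ler_pdivlMr // subr_gt0.
elim: n nu => [|n IH nu]; first by rewrite expr0 mul0r; lra.
have nn : 0 <= n%:R * u by rewrite mulr_ge0.
rewrite -natr1 in nu *.
have {}IH : (1 + u) ^+ n * (1 - n%:R * u) <= 1 by apply: IH; lra.
apply: le_trans IH; rewrite exprS mulrC mulrA [leRHS]mulrC.
have e0 : 0 <= (1 + u) ^+ n by rewrite exprn_ge0 //; lra.
rewrite ler_wpM2r //.
have h1 := mulr_ge0 u0 nn; have h2 := mulr_ge0 u0 u0; nra.
Qed.

Lemma gamE (u m : R) : m * u < 1 -> 1 + gam u m = (1 - m * u)^-1.
Proof. by move=> mu; rewrite /gam; field; rewrite subr_eq0 gt_eqF. Qed.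

Lemma gam_ge0 (u m : R) : 0 <= u -> 0 <= m -> m * u < 1 -> 0 <= gam u m.
Proof.
move=> u0 m0 mu; apply: divr_ge0; first exact: mulr_ge0.
by rewrite subr_ge0 ltW.
Qed.

Lemma le_gam (u m : R) : 0 <= u -> 0 <= m -> m * u < 1 -> m * u <= gam u m.
Proof.
move=> u0 m0 mu; rewrite /gam -[leLHS]mulr1 ler_wpM2l ?mulr_ge0 //.
by rewrite invf_ge1 ?subr_gt0 // gerBl mulr_ge0.
Qed.

Lemma expr1D_gam n (u : R) : 0 <= u -> n%:R * u < 1 -> (1 + u) ^+ n - 1 <= gam u n%:R.
Proof. by move=> u0 nu; rewrite lerBlDl gamE // expr1D_le. Qed.

End Rounding.

(** * Rounding errors of one refinement step *)

Section LowPrecisionStep.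
Variable R : realType.

Lemma fl_mx_err m n (u : R) (A B : 'M[R]_(m, n)) : 0 <= u -> fl_mx u A B ->
  normF (B - A) <= u * normF A.
Proof.
move=> u0 AB; apply: normF_le_scale => // i j.
have [d du Bij] := AB i j; rewrite !mxE Bij.
have -> : A i j * (1 + d) - A i j = d * A i j by ring.
by rewrite normrM ler_wpM2r.
Qed.

(** The error is measured here against the computed value. *)
Lemma fl_mx_err_computed m n (u : R) (A B : 'M[R]_(m, n)) : 0 <= u -> u < 1 ->
  fl_mx u A B -> normF (B - A) <= gam u 1 * normF B.
Proof.
move=> u0 u1 AB; have g0 : 0 <= gam u 1 by apply: gam_ge0; rewrite ?mul1r.
apply: normF_le_scale => // i j.
have [d du Bij] := AB i j; rewrite !mxE Bij /gam mul1r.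
have -> : A i j * (1 + d) - A i j = d * A i j by ring.
have d1 : 1 - u <= `|1 + d| by have := ler_normB (1 + d) d; rewrite addrK normr1; lra.
rewrite !normrM mulrCA mulrC ler_wpM2l // mulrAC ler_pdivlMr; last by lra.
by apply: ler_pM => //; lra.
Qed.

Lemma residual_err n (u : R) (A X P : 'M[R]_n) : (0 < n)%N -> 0 <= u ->
  n.+1%:R * u < 1 -> computed_residual u A X P ->
  normF (P - (A - X *m X)) <= gam u n.+1%:R * (normF A + normF X ^+ 2).
Proof.
move=> n0 u0 nu [W XW AP].
have g0 : 0 <= gam u n.+1%:R by apply: gam_ge0.
have gle := expr1D_gam u0 nu; set g := gam u n.+1%:R in g0 gle *.
have e1 : 1 <= (1 + u) ^+ n by rewrite exprn_ege1 //; lra.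
have ug : u <= g by move: gle; rewrite exprS; nra.
pose aX := map_mx Num.norm X.
apply: le_trans (_ : normF (g *: (map_mx Num.norm A + aX *m aX)) <= _); last first.
  rewrite normFZ ger0_norm // ler_wpM2l // (le_trans (ler_normFD _ _)) //.
  by rewrite normF_abs lerD2l (le_trans (normFM _ _)) // normF_abs -expr2.
apply: normF_le_entries => i j; rewrite [leRHS]mxE [X in g * X]mxE.
have -> : (P - (A - X *m X)) i j = P i j - (A i j - (X *m X) i j).
  by rewrite [LHS]mxE [X in _ + X]mxE [X in _ - X]mxE [X in _ - (_ + X)]mxE.
have -> : map_mx Num.norm A i j = `|A i j| by rewrite mxE.
have [d du ->] := AP i j.
have -> : (A - W) i j = A i j - W i j by rewrite [LHS]mxE [X in _ + X]mxE.
have := fl_mulmx_entry i j n0 u0 XW; rewrite -/aX.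
set x := (X *m X) i j; set y := (aX *m aX) i j; set w := W i j; set a := A i j.
have xy : `|x| <= y.
  rewrite /x /y !mxE; apply: le_trans (ler_norm_sum _ _ _) _.
  by apply: ler_sum => k _; rewrite !mxE normrM.
move=> wx.
have -> : (a - w) * (1 + d) - (a - x) = d * a - (1 + d) * (w - x) - d * x by ring.
have h1 : `|d * a| <= u * `|a| by rewrite normrM ler_wpM2r.
have h2 : `|d * x| <= u * y by rewrite normrM ler_pM.
have h3 : `|(1 + d) * (w - x)| <= (1 + u) * (((1 + u) ^+ n - 1) * y).
  rewrite normrM ler_pM //; apply: le_trans (ler_normD _ _) _.
  by rewrite normr1 lerD2l.
have y0 : 0 <= y by apply: le_trans xy.
have ha : u * `|a| <= g * `|a| by rewrite ler_wpM2r.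
have hy : ((1 + u) ^+ n.+1 - 1) * y <= g * y by rewrite ler_wpM2r.
apply: le_trans (ler_normB _ _) _; apply: le_trans (lerD (ler_normB _ _) h2) _.
apply: le_trans (lerD (lerD h1 h3) (lexx _)) _.
rewrite exprS in hy; move: ha hy; set f := (1 + u) ^+ n; lra.
Qed.

(** The solution of [S Y + Y S = C], where [S] is the diagonal matrix of [s]. *)
Definition sylv n (s : 'rV[R]_n) (C : 'M[R]_n) : 'M[R]_n :=
  \matrix_(i, j) (C i j / (s 0 i + s 0 j)).

Lemma sylvD n (s : 'rV[R]_n) C D : sylv s (C + D) = sylv s C + sylv s D.
Proof. by apply/matrixP => i j; rewrite !mxE mulrDl. Qed.

Lemma sylvB n (s : 'rV[R]_n) C D : sylv s (C - D) = sylv s C - sylv s D.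
Proof. by apply/matrixP => i j; rewrite !mxE mulrBl. Qed.

Lemma sylvK n (s : 'rV[R]_n) Y : (forall i, 0 < s 0 i) ->
  sylv s (diag_mx s *m Y + Y *m diag_mx s) = Y.
Proof.
move=> s0; apply/matrixP => i j; rewrite mxE mul_diag_mx mul_mx_diag !mxE.
by rewrite [Y i j * _]mulrC -mulrDl mulrAC divff ?mul1r // gt_eqF ?addr_gt0.
Qed.

Lemma normF_sylv n (s : 'rV[R]_n) C m : 0 < m -> (forall i, m <= s 0 i) ->
  normF (sylv s C) <= (2 * m)^-1 * normF C.
Proof.
move=> m0 ms; have m2 : 0 < 2 * m by lra.
apply: normF_le_scale => [|i j]; first by rewrite invr_ge0 ltW.
have := ms i; have := ms j => mj mi.
rewrite mxE normrM mulrC ler_wpM2r // ger0_norm ?lef_pV2 ?posrE ?invr_ge0; lra.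
Qed.

Lemma computed_sylvester_err n (u : R) (s : 'rV[R]_n) C Y : 0 <= u -> u < 1 ->
  (forall i, 0 < s 0 i) -> computed_sylvester u s C Y ->
  normF (Y - sylv s C) <= (2 * u / (1 - u)) * normF (sylv s C).
Proof.
move=> u0 u1 s0 CY; apply: normF_le_scale => [|i j].
  by rewrite divr_ge0 ?mulr_ge0 //; lra.
have [d [d1 d1u ->] [d2 d2u Yij]] := CY i j; rewrite !mxE Yij.
have sij : s 0 i + s 0 j != 0 by rewrite gt_eqF ?addr_gt0.
have := ler_norm d1; have := ler_norm (- d1); rewrite normrN => nd1 nd2.
have d10 : 0 < 1 + d1 by lra.
have -> : C i j / ((s 0 i + s 0 j) * (1 + d1)) * (1 + d2) - C i j / (s 0 i + s 0 j)
   = (d2 - d1) / (1 + d1) * (C i j / (s 0 i + s 0 j)).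
  by field; rewrite sij gt_eqF.
rewrite normrM ler_wpM2r // normrM [`|_^-1|]ger0_norm ?invr_ge0 ?(ltW d10) //.
apply: ler_pM => //; first by rewrite invr_ge0 ltW.
  by apply: le_trans (ler_normB _ _) _; lra.
by rewrite lef_pV2 ?posrE; lra.
Qed.

(** The correction that exact arithmetic attaches to the residual [P]. *)
Definition correction n (Q : 'M[R]_n) (s : 'rV[R]_n) (P : 'M[R]_n) : 'M[R]_n :=
  Q *m sylv s (Q^T *m P *m Q) *m Q^T.

Lemma correctionD n (Q : 'M[R]_n) (s : 'rV[R]_n) P F :
  correction Q s (P + F) = correction Q s P + correction Q s F.
Proof. by rewrite /correction mulmxDr mulmxDl sylvD mulmxDr mulmxDl. Qed.

(** The computed correction carries the roundoffs of four matrix products, of the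
    conversion of the residual (one factor [1 + u]), and of one addition and one
    division (together [(1 + u) / (1 - u)]). *)
Lemma correction_err n (u q r m : R) (Q P Rl C Y DX : 'M[R]_n) (s : 'rV[R]_n) :
  (0 < n)%N -> 0 <= u -> u < 1 -> 0 <= q -> 0 <= r ->
  opbound Q q -> opbound Q^T q -> normF Q <= r * q ->
  0 < m -> (forall i, m <= s 0 i) ->
  fl_mx u P Rl -> fl_mulmx3 u Q^T Rl Q C -> computed_sylvester u s C Y ->
  fl_mulmx3 u Q Y Q^T DX ->
  normF (DX - correction Q s P) <=
    (((1 + ((1 + u) ^+ n - 1) * r) ^+ 4) * ((1 + u) ^+ 2 / (1 - u)) - 1)
      * (q ^+ 4 * (2 * m)^-1 * normF P).
Proof.
move=> n0 u0 u1 q0 r0 Qq QTq Qr m0 ms PR RC CY YD.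
have QTTq : opbound (Q^T)^T q by rewrite trmxK.
have QTr : normF Q^T <= r * q by rewrite normF_tr.
have s0 i : 0 < s 0 i by apply: lt_le_trans (ms i).
set f := 1 + ((1 + u) ^+ n - 1) * r.
have f1 : 1 <= f.
  by rewrite lerDl mulr_ge0 // subr_ge0 exprn_ege1 //; lra.
have e1 := fl_mx_err u0 PR.
have e2 := fl_mulmx3_err n0 u0 q0 r0 QTq QTq QTr Qr RC.
have e3 := computed_sylvester_err u0 u1 s0 CY.
have e4 := fl_mulmx3_err n0 u0 q0 r0 Qq QTTq Qr QTr YD.
rewrite -/f in e2 e4.
set k := (2 * m)^-1; have k0 : 0 <= k by rewrite invr_ge0; lra.
set p := normF P in e1 *; have p0 : 0 <= p by exact: normF_ge0.
have q20 : 0 <= q ^+ 2 by exact: sqr_ge0.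
have f21 : 1 <= f ^+ 2 by rewrite exprn_ege1.
have Rn : normF Rl <= (1 + u) * p.
  by have := ler_normFD (Rl - P) P; rewrite subrK -/p; lra.
(* C against the product with the unconverted residual P *)
have eC : normF (C - Q^T *m P *m Q) <= (f ^+ 2 * (1 + u) - 1) * (q ^+ 2 * p).
  rewrite -(subrKA (Q^T *m Rl *m Q)) -mulmxBl -mulmxBr.
  apply: le_trans (ler_normFD _ _) _; apply: le_trans (lerD e2 _) _.
    exact: (normF_congr _ q0 QTq QTq).
  have h1 : (f ^+ 2 - 1) * (q ^+ 2 * normF Rl) <=
      (f ^+ 2 - 1) * (q ^+ 2 * ((1 + u) * p)).
    by rewrite ler_wpM2l ?subr_ge0 // ler_wpM2l.
  have h2 : q ^+ 2 * normF (Rl - P) <= q ^+ 2 * (u * p) by rewrite ler_wpM2l.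
  by apply: le_trans (lerD h1 h2) _; apply: ler_eq; ring.
have nC : normF C <= f ^+ 2 * (1 + u) * (q ^+ 2 * p).
  have h1 : normF (Q^T *m P *m Q) <= q ^+ 2 * p by exact: (normF_congr _ q0 QTq QTq).
  by have := ler_normFD (C - Q^T *m P *m Q) (Q^T *m P *m Q); rewrite subrK; lra.
set b := 2 * u / (1 - u) in e3.
have b1 : 1 + b = (1 + u) / (1 - u) by rewrite /b; field; lra.
have b0 : 0 <= b by rewrite divr_ge0 ?mulr_ge0 //; lra.
have eY : normF (Y - sylv s (Q^T *m P *m Q)) <=
    (f ^+ 2 * (1 + u) * (1 + b) - 1) * (k * (q ^+ 2 * p)).
  rewrite -(subrKA (sylv s C)) -sylvB; apply: le_trans (ler_normFD _ _) _.
  have h1 : normF (sylv s (C - Q^T *m P *m Q)) <=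
      k * ((f ^+ 2 * (1 + u) - 1) * (q ^+ 2 * p)).
    by apply: le_trans (normF_sylv _ m0 ms) _; rewrite ler_wpM2l.
  have h2 : normF (sylv s C) <= k * (f ^+ 2 * (1 + u) * (q ^+ 2 * p)).
    by apply: le_trans (normF_sylv _ m0 ms) _; rewrite ler_wpM2l.
  apply: le_trans (lerD (le_trans e3 (ler_wpM2l b0 h2)) h1) _.
  by apply: ler_eq; ring.
have nY : normF Y <= f ^+ 2 * (1 + u) * (1 + b) * (k * (q ^+ 2 * p)).
  have h1 : normF (sylv s (Q^T *m P *m Q)) <= k * (q ^+ 2 * p).
    apply: le_trans (normF_sylv _ m0 ms) _; rewrite ler_wpM2l //.
    exact: (normF_congr _ q0 QTq QTq).
  have := ler_normFD (Y - sylv s (Q^T *m P *m Q)) (sylv s (Q^T *m P *m Q)).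
  by rewrite subrK; lra.
rewrite -(subrKA (Q *m Y *m Q^T)) /correction -mulmxBl -mulmxBr.
apply: le_trans (ler_normFD _ _) _; apply: le_trans (lerD e4 _) _.
  exact: (normF_congr _ q0 Qq QTTq).
have f2m : 0 <= f ^+ 2 - 1 by rewrite subr_ge0.
apply: le_trans (lerD (ler_wpM2l f2m (ler_wpM2l q20 nY)) (ler_wpM2l q20 eY)) _.
have -> : (1 + u) ^+ 2 / (1 - u) = (1 + u) * (1 + b) by rewrite b1; field; lra.
by apply: ler_eq; ring.
Qed.

Lemma normF_correction n (q m : R) (Q P : 'M[R]_n) (s : 'rV[R]_n) :
  0 <= q -> opbound Q q -> opbound Q^T q -> 0 < m -> (forall i, m <= s 0 i) ->
  normF (correction Q s P) <= q ^+ 4 * (2 * m)^-1 * normF P.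
Proof.
move=> q0 Qq QTq m0 ms; have QTTq : opbound (Q^T)^T q by rewrite trmxK.
apply: le_trans (normF_congr _ q0 Qq QTTq) _.
have -> : q ^+ 4 * (2 * m)^-1 * normF P = q ^+ 2 * ((2 * m)^-1 * (q ^+ 2 * normF P)).
  by move: (_^-1) => k; ring.
rewrite ler_wpM2l ?sqr_ge0 //.
apply: le_trans (normF_sylv _ m0 ms) _.
apply: ler_wpM2l; last exact: (normF_congr _ q0 QTq QTq).
by rewrite invr_ge0; lra.
Qed.

(** The low precision roundoffs of a refinement step collect into one constant:
    with [w = sqrt n * n * u], the factors are at most [(1 - w)^-4] and
    [(1 - u)^-3]. *)
Lemma low_precision_factor n (u : R) : (0 < n)%N -> 0 <= u ->
  Num.sqrt n%:R * (4 * n + 3)%:R * u < 1 ->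
  (1 + ((1 + u) ^+ n - 1) * Num.sqrt n%:R) ^+ 4 * ((1 + u) ^+ 2 / (1 - u))
    <= 1 + gam u (Num.sqrt n%:R * (4 * n + 3)%:R).
Proof.
move=> n0 u0; set v := Num.sqrt _ => vu.
have v1 : 1 <= v by rewrite -sqrtr1 ler_wsqrtr // ler1n.
have n1 : 1 <= n%:R :> R by rewrite ler1n.
rewrite gamE //; move: vu; rewrite natrD natrM => vu.
set w := v * n%:R * u; set z := v * u.
have w0 : 0 <= w by rewrite !mulr_ge0 //; lra.
have uz : u <= z by rewrite ler_peMl.
have vuE : v * (4 * n%:R + 3) * u = 4 * w + 3 * z by rewrite /w /z; ring.
rewrite vuE in vu *.
have nuw : n%:R * u <= w by rewrite /w -mulrA ler_peMl // mulr_ge0.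
have h1 : 1 + ((1 + u) ^+ n - 1) * v <= (1 - w)^-1.
  have := expr1D_gam (n := n) u0 (ltac:(lra)) => h.
  have -> : (1 - w)^-1 = 1 + w / (1 - w) by field; lra.
  have v0 : 0 <= v by lra.
  rewrite lerD2l mulrC (le_trans (ler_wpM2l v0 h)) // /gam !mulrA -/w.
  by rewrite ler_wpM2l // lef_pV2 ?posrE; lra.
have f0 : 1 <= 1 + ((1 + u) ^+ n - 1) * v.
  by rewrite lerDl mulr_ge0 ?subr_ge0 ?exprn_ege1 //; lra.
have h4 : (1 + ((1 + u) ^+ n - 1) * v) ^+ 4 <= (1 - w)^-1 ^+ 4.
  by rewrite ler_pXn2r // ?nnegrE ?invr_ge0; lra.
have h5 : (1 + u) ^+ 2 / (1 - u) <= (1 - u)^-1 ^+ 3.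
  have hi : 1 + u <= (1 - u)^-1.
    by rewrite -[leRHS]mul1r ler_pdivlMr; [have := sqr_ge0 u; lra | lra].
  have i0 : 0 <= (1 - u)^-1 by rewrite invr_ge0; lra.
  rewrite [leRHS]exprSr ler_wpM2r // ler_pXn2r // nnegrE //; lra.
apply: le_trans (ler_pM _ _ h4 h5) _.
- by rewrite exprn_ge0 //; lra.
- by rewrite divr_ge0 ?sqr_ge0 //; lra.
rewrite !exprVn -invfM lef_pV2 ?posrE ?mulr_gt0 ?exprn_gt0; try lra.
have a1 : 1 - 4 * w <= (1 - w) ^+ 4.
  have -> : (1 - w) ^+ 4 = 1 - 4 * w + w ^+ 2 * (w ^+ 2 - 4 * w + 6) by ring.
  by rewrite lerDl mulr_ge0 ?sqr_ge0 //; have := sqr_ge0 w; lra.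
have a2 : 1 - 3 * u <= (1 - u) ^+ 3.
  have -> : (1 - u) ^+ 3 = 1 - 3 * u + u ^+ 2 * (3 - u) by ring.
  by rewrite lerDl mulr_ge0 ?sqr_ge0 //; lra.
apply: le_trans (ler_pM _ _ a1 a2); [|lra|lra].
by have := mulr_ge0 w0 u0; lra.
Qed.

End LowPrecisionStep.

(** * The Kronecker sum *)

Section KroneckerSum.
Variable R : realType.

Lemma inj_unitmx n (A : 'M[R]_n) :
  (forall x : 'cV[R]_n, A *m x = 0 -> x = 0) -> A \in unitmx.
Proof.
move=> Ainj; rewrite -unitmx_tr -row_free_unit -kermx_eq0.
apply/eqP/row_matrixP => i; rewrite row0; set y := row i _.
have yA : y *m A^T = 0 by apply/sub_kermxP; exact: row_sub.
apply: trmx_inj; rewrite trmx0; apply: Ainj.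
by rewrite -[A *m _]trmxK trmx_mul trmxK yA trmx0.
Qed.

(** The square matrix whose entries, read row by row, form the vector [v]. *)
Definition unvec n (v : 'cV[R]_(n * n)) : 'M[R]_n :=
  \matrix_(i, j) v (mxtens_index (i, j)) 0.

Lemma tens_mulvec n (P M : 'M[R]_n) (v : 'cV[R]_(n * n)) :
  unvec (P *t M *m v) = P *m unvec v *m M^T.
Proof.
apply/matrixP => i j; rewrite !mxE.
rewrite (reindex (fun p => mxtens_index p)) /=; last first.
  by apply: onW_bij; exists (@mxtens_unindex n n);
     [exact: mxtens_indexK | exact: mxtens_unindexK].
transitivity (\sum_(k < n) \sum_(l < n) P i k * M j l * unvec v k l).
  rewrite [RHS]pair_bigA /=; apply: eq_bigr => -[k l] _.
  by rewrite tensmxE [unvec v k l]mxE.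
rewrite exchange_big; apply: eq_bigr => l _; rewrite !mxE mulr_suml.
by apply: eq_bigr => k _; rewrite mulrAC.
Qed.

Lemma kron_sum_unit n (X : 'M[R]_n) a : X^T = X -> 0 < a -> coercive X a ->
  kron_sum X \in unitmx.
Proof.
move=> Xsym a0 Xa; apply: inj_unitmx => v.
have -> : kron_sum X *m v = (1%:M *t X) *m v + (X^T *t 1%:M) *m v.
  by rewrite -mulmxDl.
move=> Xv; have Z0 : unvec v = 0.
  apply: normF_eq0; apply/eqP; rewrite eq_le normF_ge0 andbT.
  have a2 : 0 < a + a by lra.
  rewrite -(ler_pM2l a2) mulr0; apply: le_trans (sylvester_coercive _ Xa Xa Xsym) _.
  have -> : X *m unvec v + unvec v *m X = 0; last by rewrite normF0.
  rewrite addrC; have := congr1 (@unvec n) Xv.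
  have unvecD (x y : 'cV[R]_(n * n)) : unvec (x + y) = unvec x + unvec y.
    by apply/matrixP => i j; rewrite !mxE.
  rewrite unvecD !tens_mulvec trmx1 mulmx1 mul1mx Xsym => ->.
  by apply/matrixP => i j; rewrite !mxE.
apply/matrixP => p j; rewrite ord1 -(mxtens_unindexK p).
case: (mxtens_unindex p) => i l; have := congr1 (fun Z : 'M_n => Z i l) Z0.
by rewrite !mxE.
Qed.

(** The Kronecker sum maps the tensor square of [x] to the sum of the tensors of
    [x] and [X x], so that its inverse has large norm whenever [X] has a small
    one on some vector. *)
Lemma kron_sum_inv_bound n (X : 'M[R]_n) (x : 'cV[R]_n) : X^T = X ->
  kron_sum X \in unitmx ->
  normF x <= 2 * norm2 (invmx (kron_sum X)) * normF (X *m x).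
Proof.
move=> Xsym Bu; have [-> | x0] := eqVneq x 0; first by rewrite mulmx0 normF0 mulr0.
have nx := normF_gt0 x0; set h := norm2 _.
have h0 : 0 <= h by exact: norm2_ge0.
rewrite -(ler_pM2l nx) -normF_tens.
set v := (x *t x : 'cV[R]_(n * n)).
have Bv : kron_sum X *m v =
    (x *t (X *m x) : 'cV[R]_(n * n)) + ((X *m x) *t x : 'cV[R]_(n * n)).
  have tens_mul (P M : 'M[R]_n) :
      P *t M *m v = ((P *m x) *t (M *m x) : 'cV[R]_(n * n)).
    exact: (tensmx_mul P M x x).
  by rewrite mulmxDl !tens_mul !mul1mx Xsym.
rewrite -[v](mulKmx Bu); apply: le_trans (norm2_opbound _ _) _; rewrite -/h Bv.
apply: le_trans (ler_wpM2l h0 (ler_normFD _ _)) _; rewrite !normF_tens.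
by apply: ler_eq; ring.
Qed.

End KroneckerSum.

(** * Nearly orthogonal matrices *)

Section NearlyOrthogonal.
(** [near_orth Q g]: the Gram matrix of [Q] is within [g < 1] of the identity. *)
Definition near_orth (R : realType) n (Q : 'M[R]_n) (g : R) : Prop :=
  [/\ 0 <= g, g < 1 & opbound (Q^T *m Q - 1%:M) g].

Variables (R : realType) (n : nat) (Q : 'M[R]_n) (g : R).
Hypothesis QG : near_orth Q g.

Lemma near_orth_gram (x : 'cV[R]_n) :
  (1 - g) * normF x ^+ 2 <= normF (Q *m x) ^+ 2 <= (1 + g) * normF x ^+ 2.
Proof.
have [g0 g1 QG1] := QG.
have := qform_le x QG1; rewrite qformD qformN qform1 qform_gram => /ler_normlP[].
by move=> h1 h2; apply/andP; split; lra.
Qed.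

Lemma near_orth_unit : Q \in unitmx.
Proof.
have [g0 g1 QG1] := QG.
apply: inj_unitmx => x Qx; apply: normF_eq0; apply/eqP; rewrite -sqrf_eq0.
have /andP[+ _] := near_orth_gram x; rewrite Qx normF0 expr0n /= => h.
have g1' : 0 < 1 - g by rewrite subr_gt0.
by rewrite eq_le sqr_ge0 andbT -(pmulr_rle0 _ g1').
Qed.

(** The transpose obeys the same bounds, by Cauchy-Schwarz applied to
    [x^T Q Q^T x] and, for the lower bound, to [x = Q w]. *)
Lemma near_orth_tr (x : 'cV[R]_n) :
  (1 - g) * normF x ^+ 2 <= normF (Q^T *m x) ^+ 2 <= (1 + g) * normF x ^+ 2.
Proof.
have [g0 g1 QG1] := QG.
have [->|x0] := eqVneq x 0; first by rewrite mulmx0 normF0 expr0n /= !mulr0 lexx.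
have nx := normF_gt0 x0.
have nQ : 0 <= normF (Q^T *m x) by exact: normF_ge0.
have E1 : normF (Q^T *m x) ^+ 2 = dotF x (Q *m (Q^T *m x)).
  by rewrite -dotFF !dotFE trmx_mul trmxK !mulmxA.
have dot_le (y z : 'cV[R]_n) : dotF y z ^+ 2 <= normF y ^+ 2 * normF z ^+ 2.
  by rewrite -exprMn -[dotF _ _ ^+ 2]real_normK ?num_real // ler_sqr ?nnegrE
     ?mulr_ge0 ?normF_ge0 // dotF_le.
apply/andP; split; last first.
  have /andP[_ h] := near_orth_gram (Q^T *m x).
  have := dot_le x (Q *m (Q^T *m x)); rewrite -E1 => hd.
  have [N0|N0] := eqVneq (normF (Q^T *m x)) 0.
    by rewrite N0 expr0n /= mulr_ge0 ?sqr_ge0 //; lra.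
  have p0 : 0 < normF (Q^T *m x) ^+ 2 by rewrite exprn_gt0 // lt_def N0.
  rewrite -(ler_pM2l p0) -expr2; apply: le_trans hd _.
  rewrite mulrC; apply: le_trans (ler_wpM2r (sqr_ge0 _) h) _.
  by apply: ler_eq; ring.
pose w := invmx Q *m x.
have Qw : Q *m w = x by rewrite mulKVmx // near_orth_unit.
have E2 : normF x ^+ 2 = dotF w (Q^T *m x).
  by rewrite -dotFF !dotFE -{1}Qw trmx_mul mulmxA.
have := dot_le w (Q^T *m x); rewrite -E2 => hd.
have /andP[h _] := near_orth_gram w; rewrite Qw in h.
have p0 : 0 < normF x ^+ 2 by rewrite exprn_gt0.
rewrite -(ler_pM2l p0) mulrCA -expr2.
have g1' : 0 <= 1 - g by lra.
apply: le_trans (ler_wpM2l g1' hd) _.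
by rewrite mulrA ler_wpM2r ?sqr_ge0.
Qed.

Let q := Num.sqrt (1 + g).

Lemma near_orth_q : q ^+ 2 = 1 + g.
Proof. by have [g0 _ _] := QG; rewrite sqr_sqrtr //; lra. Qed.

Lemma near_orth_opbound : opbound Q q.
Proof.
have [g0 g1 QG1] := QG.
move=> x; apply: normF_le_sqr; first by rewrite mulr_ge0 ?sqrtr_ge0 ?normF_ge0.
rewrite exprMn near_orth_q.
by have /andP[] := near_orth_gram x.
Qed.

Lemma near_orth_opbound_tr : opbound Q^T q.
Proof.
have [g0 g1 QG1] := QG.
move=> x; apply: normF_le_sqr; first by rewrite mulr_ge0 ?sqrtr_ge0 ?normF_ge0.
rewrite exprMn near_orth_q.
by have /andP[] := near_orth_tr x.
Qed.

Lemma normF_near_orth_le m (Z : 'M[R]_(n, m)) :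
  (1 - g) * normF Z ^+ 2 <= normF (Q *m Z) ^+ 2.
Proof.
have [g0 g1 QG1] := QG.
rewrite !normF_col mulr_sumr; apply: ler_sum => j _; rewrite col_mulmx.
by have /andP[] := near_orth_gram (col j Z).
Qed.

Lemma normF_congr_ge (Z : 'M[R]_n) : (1 - g) * normF Z <= normF (Q *m Z *m Q^T).
Proof.
have [g0 g1 QG1] := QG.
have g1' : 0 <= 1 - g by lra.
rewrite -ler_sqr ?nnegrE ?mulr_ge0 ?normF_ge0 //.
rewrite -mulmxA; apply: le_trans (normF_near_orth_le _).
rewrite -(normF_tr (Z *m _)) trmx_mul trmxK exprMn expr2 -mulrA ler_wpM2l //.
by apply: le_trans (normF_near_orth_le _); rewrite normF_tr.
Qed.

Lemma normF_congr_le (Z : 'M[R]_n) : normF (Q *m Z *m Q^T) <= (1 + g) * normF Z.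
Proof.
have [g0 g1 QG1] := QG.
rewrite -near_orth_q.
apply: normF_congr; first exact: sqrtr_ge0.
  exact: near_orth_opbound.
by rewrite trmxK; exact: near_orth_opbound.
Qed.

Lemma normF_congr_tr_le (Z : 'M[R]_n) : normF (Q^T *m Z *m Q) <= (1 + g) * normF Z.
Proof.
have [g0 g1 QG1] := QG.
rewrite -near_orth_q.
by apply: normF_congr; [exact: sqrtr_ge0 | exact: near_orth_opbound_tr..].
Qed.

(** Bounds on the computed eigenvalues: with [Q^T y] a basis vector, the entry
    [t 0 i] is the value of the quadratic form of [A + E] at [y]. *)
Lemma spectral_bounds (A E : 'M[R]_n) (t : 'rV[R]_n) a0 a1 b i :
  A + E = Q *m diag_mx t *m Q^T -> coercive A a0 -> opbound A a1 ->
  opbound E b -> b <= a0 -> 0 <= a1 + b ->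
  (a0 - b) <= t 0 i * (1 + g) /\ t 0 i * (1 - g) <= a1 + b.
Proof.
have [g0 g1 QG1] := QG.
move=> AE Aa0 Aa1 Eb ba ab.
have QTu : Q^T \in unitmx by rewrite unitmx_tr near_orth_unit.
pose y := invmx Q^T *m (delta_mx i 0 : 'cV[R]_n).
have Qy : Q^T *m y = delta_mx i 0 by rewrite mulKVmx.
have ti : t 0 i = qform A y + qform E y.
  rewrite -qformD AE -[X in X *m _ *m _]trmxK qform_congr Qy qform_diag.
  rewrite (bigD1 i) //= mxE !eqxx expr1n mulr1 big1 ?addr0 // => j ji.
  by rewrite mxE (negPf ji) expr0n mulr0.
have := near_orth_tr y; rewrite Qy normF_delta expr1n => /andP[yu yl].
have y0 : 0 <= normF y ^+ 2 by exact: sqr_ge0.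
have := qform_le y Eb => /ler_normlP[e1 e2].
have := Aa0 y; have := le_trans (ler_norm _) (qform_le y Aa1).
move: e1 e2 yu yl y0; rewrite ti.
move: (qform A y) (qform E y) (normF y ^+ 2) => x z w e1 e2 yu yl w0 x1 x0.
split.
  have := ler_wpM2l (ltac:(lra) : 0 <= a0 - b) yl.
  have := ler_wpM2r (ltac:(lra) : 0 <= 1 + g) (ltac:(lra) : (a0 - b) * w <= x + z).
  lra.
have := ler_wpM2l ab yu.
have := ler_wpM2r (ltac:(lra) : 0 <= 1 - g) (ltac:(lra) : x + z <= (a1 + b) * w).
lra.
Qed.

End NearlyOrthogonal.

(** * The principal square root *)

Section PrincipalSqrt.
Variables (R : realType) (n : nat) (A X : 'M[R]_n).
Hypothesis n0 : (0 < n)%N.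
Hypothesis X_sqrt : principal_sqrt A X.
Let L := norm2 (invmx X).

Lemma sqrt_sym : X^T = X. Proof. by case: X_sqrt => [[]]. Qed.

Lemma sqrt_unit : X \in unitmx.
Proof.
have [[_ Xpos] _] := X_sqrt; apply: inj_unitmx => x Xx.
apply/eqP; apply: contraT => /Xpos.
by rewrite -mulmxA Xx mulmx0 mxE ltxx.
Qed.

Lemma sqrt_inv_gt0 : 0 < L.
Proof.
rewrite lt_def norm2_ge0 andbT; apply/eqP => L0.
pose x : 'cV[R]_n := delta_mx (Ordinal n0) 0.
have := norm2_opbound (invmx X) (X *m x).
by rewrite (mulKmx sqrt_unit) -/L L0 mul0r normF_delta ler10.
Qed.

Lemma normF_sqrt_ge (x : 'cV[R]_n) : L^-1 * normF x <= normF (X *m x).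
Proof.
rewrite mulrC ler_pdivrMr ?sqrt_inv_gt0 // mulrC -{1}(mulKmx sqrt_unit x).
exact: norm2_opbound.
Qed.

Lemma coercive_sqrt : coercive X L^-1.
Proof.
move=> x; have L0 := sqrt_inv_gt0.
have [z Xz zx] : exists2 z, X *m z = x & normF z <= L * normF x.
  exists (invmx X *m x); first by rewrite mulKVmx // sqrt_unit.
  exact: norm2_opbound.
(* The lower bound is the nonnegativity of the form of X at x - z / L. *)
have : 0 <= qform X (x - L^-1 *: z).
  have [->|y0] := eqVneq (x - L^-1 *: z) 0.
    by rewrite qformE mulmx0 dotFE mulmx0 mxtrace0.
  by have [[_ Xpos] _] := X_sqrt; exact: ltW (Xpos _ y0).
have zX : dotF z (X *m x) = normF x ^+ 2.
  by rewrite -dotFF -{2}Xz !dotFE trmx_mul sqrt_sym mulmxA.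
have -> : qform X (x - L^-1 *: z) =
    qform X x - 2 * L^-1 * normF x ^+ 2 + L^-1 ^+ 2 * dotF z x.
  rewrite qformE mulmxBr -scalemxAr Xz -!scaleNr dotFDr dotFZr.
  rewrite !(dotFC (x + _)) !dotFDr !dotFZr (dotFC _ z) (dotFC _ z) zX (dotFC _ x).
  by rewrite -qformE dotFF; ring.
have hz : dotF z x <= L * normF x ^+ 2.
  apply: le_trans (le_trans (ler_norm _) (dotF_le _ _)) _.
  by rewrite expr2 mulrA ler_wpM2r ?normF_ge0.
have := ler_wpM2l (sqr_ge0 L^-1) hz.
have -> : L^-1 ^+ 2 * (L * normF x ^+ 2) = L^-1 * normF x ^+ 2 by field; lra.
lra.
Qed.

Lemma coercive_of_sqrt : coercive A (L^-1 ^+ 2).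
Proof.
move=> x; have [_ <-] := X_sqrt; rewrite -{1}sqrt_sym qform_gram -exprMn.
rewrite ler_sqr ?nnegrE ?mulr_ge0 ?normF_ge0 ?invr_ge0 ?(ltW sqrt_inv_gt0) //.
exact: normF_sqrt_ge.
Qed.

Lemma sqr_norm2_inv_sqrt : L ^+ 2 <= norm2 (invmx A).
Proof.
have [_ XX] := X_sqrt.
have : L <= Num.sqrt (norm2 (invmx A)).
  apply: norm2_le; first exact: sqrtr_ge0.
  move=> x; apply: normF_le_sqr; first by rewrite mulr_ge0 ?sqrtr_ge0 ?normF_ge0.
  rewrite exprMn (sqr_sqrtr (norm2_ge0 _)).
  rewrite -qform_gram trmx_inv sqrt_sym.
  have -> : invmx X *m invmx X = invmx A.
    have Xu := sqrt_unit; have Au : A \in unitmx by rewrite -XX unitmx_mul Xu.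
    have AI : A *m (invmx X *m invmx X) = 1%:M.
      by rewrite -XX mulmxA (mulmxK Xu) mulmxV.
    by rewrite -[RHS]mulmx1 -AI mulKmx.
  exact: le_trans (ler_norm _) (qform_le _ (@norm2_opbound _ _ _ _)).
rewrite -ler_sqr ?nnegrE ?sqrtr_ge0 ?(ltW sqrt_inv_gt0) // sqr_sqrtr ?norm2_ge0 //.
Qed.

Lemma normF_of_sqrt : normF A <= normF X ^+ 2.
Proof. by have [_ <-] := X_sqrt; rewrite expr2 normFM. Qed.

Lemma ge1_cond_sqrt : 1 <= L * normF X.
Proof.
pose x : 'cV[R]_n := delta_mx (Ordinal n0) 0.
have := normF_sqrt_ge x; rewrite normF_delta mulr1 => h.
have := le_trans h (normFM _ _); rewrite normF_delta mulr1 => hx.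
by rewrite -(ler_pM2l (x := L^-1)) ?invr_gt0 ?sqrt_inv_gt0 //
   mulr1 mulKf // gt_eqF ?sqrt_inv_gt0.
Qed.

Lemma ge1_cond_norm2 : 1 <= L ^+ 2 * norm2 A.
Proof.
pose x : 'cV[R]_n := delta_mx (Ordinal n0) 0.
have L0 := sqrt_inv_gt0.
have := le_trans (coercive_of_sqrt x)
  (le_trans (ler_norm _) (qform_le x (@norm2_opbound _ _ _ _))).
rewrite normF_delta expr1n !mulr1 exprVn => h.
rewrite -(ler_pM2l (x := (L ^+ 2)^-1)) ?invr_gt0 ?exprn_gt0 // mulr1 mulKf //.
by rewrite gt_eqF // exprn_gt0.
Qed.

End PrincipalSqrt.

(** * The computed factors *)

(** Here [L] is the spectral norm of the inverse of [X], [N] the Frobenius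
    norm of [X], [a] the spectral norm of [A] and [rt] the vector of exact square
    roots of the computed eigenvalues. *)

Section ComputedFactors.
Variables (R : realType) (n : nat) (A X Q E : 'M[R]_n) (t s : 'rV[R]_n) (g ul : R).
Hypothesis n0 : (0 < n)%N.
Hypothesis X_sqrt : principal_sqrt A X.
Hypothesis g_ge0 : 0 <= g.
Hypothesis QG : near_orth Q g.
Hypothesis AE : A + E = Q *m diag_mx t *m Q^T.
Hypothesis Eb : opbound E (g * norm2 A).
Hypothesis g_small : Num.sqrt n%:R * g * norm2 (invmx A) * normF A <= 1 / 52.
Hypothesis ul0 : 0 <= ul.
Hypothesis ul_small : ul * (norm2 (invmx X) * normF X) <= 1 / 84.
Hypothesis s_sqrt : forall i, fl ul (Num.sqrt (t 0 i)) (s 0 i).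

Let L := norm2 (invmx X).
Let N := normF X.
Let a := norm2 A.
Let rt : 'rV[R]_n := map_mx Num.sqrt t.

Lemma sqrtn_ge1 : 1 <= Num.sqrt n%:R :> R.
Proof. by rewrite -[leLHS]sqrtr1 ler_wsqrtr // ler1n. Qed.

Lemma sqrtn_ga : Num.sqrt n%:R * (g * a) * L ^+ 2 <= 1 / 52.
Proof.
have g0 := g_ge0; apply: le_trans g_small.
have -> : Num.sqrt n%:R * g * norm2 (invmx A) * normF A =
   Num.sqrt n%:R * (g * normF A) * norm2 (invmx A) by ring.
have L2 := sqr_norm2_inv_sqrt n0 X_sqrt.
apply: ler_pM => //.
- by rewrite !mulr_ge0 ?sqrtr_ge0 ?norm2_ge0.
- exact: sqr_ge0.
- by rewrite ler_wpM2l ?sqrtr_ge0 // ler_wpM2l // norm2_le_normF.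
Qed.

Lemma ga_small : g * a * L ^+ 2 <= 1 / 52.
Proof.
have g0 := g_ge0; apply: le_trans sqrtn_ga; rewrite -!mulrA.
apply: ler_peMl; last exact: sqrtn_ge1.
by rewrite !mulr_ge0 ?norm2_ge0 ?sqr_ge0.
Qed.

Lemma g_le : g <= 1 / 52.
Proof.
have g0 := g_ge0; apply: le_trans ga_small; rewrite -mulrA ler_peMr // mulrC.
exact: (ge1_cond_norm2 n0 X_sqrt).
Qed.

Lemma ul_le : ul <= 1 / 84.
Proof.
apply: le_trans ul_small; rewrite ler_peMr // ?ul0 //.
exact: (ge1_cond_sqrt n0 X_sqrt).
Qed.

Lemma t_bounds i : 51 / 53 <= t 0 i * L ^+ 2 /\ t 0 i * 51 <= 53 * a.
Proof.
have [g0 g1 _] := QG; have gl := g_le; have gas := ga_small.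
have a0 : 0 <= a by exact: norm2_ge0.
have L0 : 0 < L by exact: (sqrt_inv_gt0 n0 X_sqrt).
have L20 : 0 < L ^+ 2 by rewrite exprn_gt0.
have ga0 : 0 <= g * a by exact: mulr_ge0.
have LL : L^-1 ^+ 2 * L ^+ 2 = 1 by rewrite exprVn mulVf // gt_eqF.
have gaL : g * a <= L^-1 ^+ 2 by rewrite -(ler_pM2r L20) LL; lra.
have [] := spectral_bounds QG i AE (coercive_of_sqrt n0 X_sqrt)
  (@norm2_opbound _ _ _ _) Eb gaL _; first by rewrite -/a; lra.
rewrite -/L -/a => h1 h2.
have h3 := ler_wpM2r (ltW L20) h1; rewrite mulrBl LL in h3.
have t0 : 0 <= t 0 i.
  have g1p : 0 < 1 + g by lra.
  by rewrite -(pmulr_lge0 _ g1p); apply: le_trans h1; rewrite subr_ge0.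
split.
  have gu : 1 + g <= 53 / 52 by lra.
  have := ler_wpM2r (mulr_ge0 t0 (ltW L20)) gu.
  by move: h3 gas; move: (L ^+ 2) (t 0 i) => L2 ti h3 gas; lra.
have gd : 51 / 52 <= 1 - g by lra.
have := ler_wpM2r t0 gd; have := ler_wpM2r a0 gl; lra.
Qed.

Lemma t_gt0 i : 0 < t 0 i.
Proof.
have [h _] := t_bounds i; have L0 : 0 < L by exact: (sqrt_inv_gt0 n0 X_sqrt).
have L20 : 0 < L ^+ 2 by rewrite exprn_gt0.
by rewrite -(pmulr_lgt0 _ L20); apply: lt_le_trans h; lra.
Qed.

Lemma rt_sqr i : rt 0 i ^+ 2 = t 0 i.
Proof. by rewrite mxE sqr_sqrtr // ltW // t_gt0. Qed.

Lemma rt_ge0 i : 0 <= rt 0 i.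
Proof. by rewrite mxE sqrtr_ge0. Qed.

Lemma s_rt i : `|s 0 i - rt 0 i| <= ul * rt 0 i.
Proof.
have [d du ->] := s_sqrt i; have := rt_ge0 i; rewrite mxE => r0.
have -> : Num.sqrt (t 0 i) * (1 + d) - Num.sqrt (t 0 i) = d * Num.sqrt (t 0 i) by ring.
by rewrite normrM [X in _ * X]ger0_norm // ler_wpM2r.
Qed.

Lemma s_lower i : 24 / 25 * L^-1 <= s 0 i.
Proof.
have L0 : 0 < L by exact: (sqrt_inv_gt0 n0 X_sqrt).
have := s_rt i => /ler_normlP[h1 _]; have r0 := rt_ge0 i.
have ul1 := ler_wpM2r r0 ul_le.
have [h _] := t_bounds i; rewrite -rt_sqr -exprMn in h.
(* 98/100 is just below the square root of 51/53. *)
have rL : 98 / 100 <= rt 0 i * L.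
  rewrite -ler_sqr ?nnegrE ?mulr_ge0 // ?(ltW L0) //; last by lra.
  by apply: le_trans h; lra.
rewrite ler_pdivrMr //.
have : 83 / 84 * (rt 0 i * L) <= s 0 i * L.
  by rewrite mulrA ler_wpM2r ?(ltW L0) //; lra.
lra.
Qed.

Lemma gs_upper i : g * s 0 i * L <= 1 / 50.
Proof.
have [g0 _ _] := QG; have L0 : 0 < L by exact: (sqrt_inv_gt0 n0 X_sqrt).
have := s_rt i => /ler_normlP[_ h1]; have r0 := rt_ge0 i.
have ul1 := ler_wpM2r r0 ul_le; have gl := g_le; have gas := ga_small.
have [_ h] := t_bounds i; rewrite -rt_sqr in h.
have a0 : 0 <= a by exact: norm2_ge0.
have gr : g * rt 0 i * L <= 1 / 51.
  rewrite -ler_sqr ?nnegrE ?mulr_ge0 // ?(ltW L0) //; last by lra.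
  have -> : (g * rt 0 i * L) ^+ 2 = g * (g * rt 0 i ^+ 2 * L ^+ 2) by ring.
  have h2 : g * rt 0 i ^+ 2 * L ^+ 2 <= 53 / 51 * (g * a * L ^+ 2).
    have -> : 53 / 51 * (g * a * L ^+ 2) = g * (53 / 51 * a) * L ^+ 2 by ring.
    by rewrite ler_wpM2r ?sqr_ge0 // ler_wpM2l //; lra.
  have h3 : g * (g * rt 0 i ^+ 2 * L ^+ 2) <= 1 / 52 * (53 / 51 * (1 / 52)).
    apply: ler_pM => //; last by lra.
    by do ?apply: mulr_ge0 => //; exact: ltW.
  by apply: le_trans h3 _; lra.
have : g * s 0 i * L <= 85 / 84 * (g * rt 0 i * L).
  have -> : 85 / 84 * (g * rt 0 i * L) = g * (85 / 84 * rt 0 i) * L by ring.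
  by rewrite ler_wpM2r ?(ltW L0) // ler_wpM2l //; lra.
lra.
Qed.

(** * The initial approximation *)

(* The approximations to X with exact and with rounded square roots. *)
Let X' := Q *m diag_mx rt *m Q^T.
Let Xt := Q *m diag_mx s *m Q^T.

(** [X' X' - A] consists of [E] and of a term due to the loss of orthogonality of
    [Q], both of Frobenius norm about [sqrt n * g * a]. *)
Lemma sqrt_perturbation : normF (X' - X) * L <= 1 / 25.
Proof.
have [g0 g1 G] := QG; have L0 : 0 < L by exact: (sqrt_inv_gt0 n0 X_sqrt).
have [_ XX] := X_sqrt; have gl := g_le; have gas := sqrtn_ga.
have a0 : 0 <= a by exact: norm2_ge0.
set v := Num.sqrt n%:R in gas *; have v0 : 0 <= v by exact: sqrtr_ge0.
set G' := Q^T *m Q - 1%:M in G.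
have TT : diag_mx rt *m diag_mx rt = diag_mx t.
  rewrite mulmx_diag; congr diag_mx; apply/rowP => i.
  by rewrite mxE -expr2 rt_sqr.
have X'X' : X' *m X' - A = E + Q *m (diag_mx rt *m G' *m diag_mx rt) *m Q^T.
  have QQ : Q^T *m Q = G' + 1%:M by rewrite subrK.
  have -> : X' *m X' = Q *m (diag_mx rt *m (Q^T *m Q) *m diag_mx rt) *m Q^T.
    by rewrite /X' !mulmxA.
  rewrite QQ mulmxDr mulmx1 mulmxDl TT mulmxDr mulmxDl -AE addrA.
  by rewrite addrAC addrK addrC.
have dE : normF E <= v * (g * a) by apply: normF_le_sqrtn => //; exact: mulr_ge0.
pose r := Num.sqrt (53 / 51 * a).
have r2 : r ^+ 2 = 53 / 51 * a by rewrite sqr_sqrtr //; lra.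
have rtr : opbound (diag_mx rt) r.
  apply: opbound_diag => [|i]; first exact: sqrtr_ge0.
  rewrite ger0_norm ?rt_ge0 // -ler_sqr ?nnegrE ?rt_ge0 ?sqrtr_ge0 //.
  by rewrite r2 rt_sqr; have [_ h] := t_bounds i; lra.
have r0 : 0 <= r by exact: sqrtr_ge0.
have dG : normF (diag_mx rt *m G' *m diag_mx rt) <= v * (r * g * r).
  apply: normF_le_sqrtn; first by rewrite !mulr_ge0.
  by apply: opboundM => //; [exact: mulr_ge0 | exact: opboundM].
have rgr : r * g * r = 53 / 51 * (g * a) by rewrite mulrAC -expr2 r2; ring.
(* 207/100 exceeds 1 + 53/52 * 53/51, for the two terms of X' X' - A. *)
have d : normF (X' *m X' - A) <= 207 / 100 * (v * (g * a)).
  rewrite X'X'; apply: le_trans (ler_normFD _ _) _.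
  apply: le_trans (lerD dE (normF_congr_le QG _)) _.
  have vga : 0 <= v * (g * a) by rewrite !mulr_ge0.
  have : (1 + g) * normF (diag_mx rt *m G' *m diag_mx rt) <=
      53 / 52 * (v * (r * g * r)).
    by apply: ler_pM => //; [lra | exact: normF_ge0 | lra].
  by rewrite rgr; lra.
have X'0 : coercive X' 0.
  move=> x; rewrite mul0r /X' -[X in X *m _ *m _]trmxK qform_congr qform_diag.
  by apply: sumr_ge0 => i _; rewrite mulr_ge0 ?rt_ge0 ?sqr_ge0.
have := sylvester_coercive (X' - X) X'0 (coercive_sqrt n0 X_sqrt) (sqrt_sym X_sqrt).
have -> : X' *m (X' - X) + (X' - X) *m X = X' *m X' - A.
  by rewrite mulmxBr mulmxBl XX addrA subrK.
rewrite add0r -/L => h.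
have h2 : normF (X' - X) <= L * (207 / 100 * (v * (g * a))).
  rewrite -(ler_pM2l (x := L^-1)) ?invr_gt0 // mulKf ?gt_eqF //.
  exact: le_trans h d.
have := ler_wpM2r (ltW L0) h2.
have -> : L * (207 / 100 * (v * (g * a))) * L =
  207 / 100 * (v * (g * a) * L ^+ 2) by ring.
lra.
Qed.

(** Rounding the square roots moves [X'] by at most [ul] times a Frobenius norm
    comparable to [N]. *)
Lemma init_perturbation : normF (Xt - X) * L <= 1 / 16.
Proof.
have [g0 g1 G] := QG; have L0 : 0 < L by exact: (sqrt_inv_gt0 n0 X_sqrt).
have gl := g_le; have pX := sqrt_perturbation; have uln := ul_small.
have LN := ge1_cond_sqrt n0 X_sqrt; rewrite -/L -/N in LN uln.
have ul0' := ul0.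
have nS : normF (diag_mx s - diag_mx rt) <= ul * normF (diag_mx rt).
  apply: normF_le_scale => // i j; rewrite !mxE; case: eqP => [_|_].
    by have := s_rt i; rewrite mxE !mulr1n [`|Num.sqrt _|]ger0_norm ?sqrtr_ge0.
  by rewrite !mulr0n subr0 normr0 mulr0.
have nX' : normF X' * L <= 26 / 25 * (L * N).
  have := ler_wpM2r (ltW L0) (ler_normFD (X' - X) X); rewrite subrK -/N; lra.
set r := normF (diag_mx rt) in nS.
have r0 : 0 <= r by exact: normF_ge0.
have nr : r * L <= 52 / 51 * (26 / 25 * (L * N)).
  have h := ler_wpM2r (ltW L0) (normF_congr_ge QG (diag_mx rt)); rewrite -/X' -/r in h.
  have : 51 / 52 * (r * L) <= (1 - g) * (r * L).
    by rewrite ler_wpM2r ?mulr_ge0 ?(ltW L0) //; lra.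
  lra.
have dS : normF (Xt - X') <= 53 / 52 * (ul * r).
  rewrite /Xt /X' -mulmxBl -mulmxBr; apply: le_trans (normF_congr_le QG _) _.
  by apply: ler_pM; [lra | exact: normF_ge0 | lra | ].
have := ler_wpM2r (ltW L0) (ler_normFD (Xt - X') (X' - X)); rewrite subrKA.
have := ler_wpM2r (ltW L0) dS.
have := ler_wpM2l ul0 nr.
have -> : 53 / 52 * (ul * r) * L = 53 / 52 * (ul * (r * L)) by ring.
have -> : ul * (52 / 51 * (26 / 25 * (L * N))) =
  52 / 51 * (26 / 25) * (ul * (L * N)) by ring.
lra.
Qed.

Lemma normF_diag_s : normF (diag_mx s) <= 52 / 51 * (17 / 16 * N).
Proof.
have [g0 g1 G] := QG; have L0 : 0 < L by exact: (sqrt_inv_gt0 n0 X_sqrt).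
have gl := g_le; have pX := init_perturbation.
have LN := ge1_cond_sqrt n0 X_sqrt; rewrite -/L -/N in LN.
have nXt : normF Xt <= 17 / 16 * N.
  rewrite -(ler_pM2r L0).
  have := ler_wpM2r (ltW L0) (ler_normFD (Xt - X) X); rewrite subrK -/N; lra.
have h := normF_congr_ge QG (diag_mx s); rewrite -/Xt in h.
have : 51 / 52 * normF (diag_mx s) <= (1 - g) * normF (diag_mx s).
  by rewrite ler_wpM2r ?normF_ge0 //; lra.
lra.
Qed.

Lemma initial_iterate_err X0 :
  let mu := gam ul (Num.sqrt n%:R * (4 * n + 3)%:R) in
  Num.sqrt n%:R * (4 * n + 3)%:R * ul < 1 -> mu * (L * N) <= 1 / 12 ->
  fl_mulmx3 ul Q (diag_mx s) Q^T X0 -> normF (X - X0) * L <= 3 / 8.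
Proof.
move=> mu vul mu_small X0_prod; have [g0 _ _] := QG; have gl := g_le.
have L0 : 0 < L by exact: (sqrt_inv_gt0 n0 X_sqrt).
have dXt := init_perturbation; have nS := normF_diag_s.
have ul0' := ul0; have ul1 := ul_le.
have Qq := near_orth_opbound QG; have QTq := near_orth_opbound_tr QG.
have q2 := near_orth_q QG; set q := Num.sqrt (1 + g) in Qq QTq q2.
have q0 : 0 <= q by exact: sqrtr_ge0.
set v := Num.sqrt n%:R in mu vul mu_small.
have v0 : 0 <= v by exact: sqrtr_ge0.
have Qr : normF Q <= v * q by exact: normF_le_sqrtn.
have QTr : normF Q^T <= v * q by rewrite normF_tr.
have QTTq : opbound (Q^T)^T q by rewrite trmxK.
have e0 := fl_mulmx3_err n0 ul0 q0 v0 Qq QTTq Qr QTr X0_prod.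
have fw := low_precision_factor n0 ul0 vul; rewrite -/v -/mu in fw.
rewrite -/Xt q2 in e0; set f := 1 + _ * v in e0 fw.
set w := _ / (1 - ul) in fw.
have f1 : 1 <= f by rewrite lerDl mulr_ge0 // subr_ge0 exprn_ege1 // lerDl.
have w1 : 1 <= w.
  rewrite ler_pdivlMr ?mul1r; last by lra.
  by apply: (@le_trans _ _ 1); [rewrite gerBl | rewrite exprn_ege1 // lerDl].
have f21 : 1 <= f ^+ 2 by rewrite exprn_ege1.
have f2 : f ^+ 2 - 1 <= mu.
  rewrite lerBlDl; apply: le_trans fw; rewrite -[leLHS]mulr1.
  apply: ler_pM => //; first by rewrite sqr_ge0.
  by rewrite (exprD f 2 2) ler_peMl // sqr_ge0.
have mu0 : 0 <= mu by apply: le_trans f2; rewrite subr_ge0.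
have e0' : normF (X0 - Xt) <= mu * (53 / 52 * (52 / 51 * (17 / 16 * N))).
  have S0 := normF_ge0 (diag_mx s).
  have g1' : 0 <= 1 + g by rewrite addr_ge0.
  apply: le_trans e0 _; apply: le_trans (ler_wpM2r (mulr_ge0 g1' S0) f2) _.
  rewrite ler_wpM2l //; apply: ler_pM => //.
  by lra.
have := ler_wpM2r (ltW L0) e0'.
have -> : mu * (53 / 52 * (52 / 51 * (17 / 16 * N))) * L =
  53 / 52 * (52 / 51) * (17 / 16) * (mu * (L * N)) by field.
have := ler_wpM2r (ltW L0) (ler_normFD (X0 - Xt) (Xt - X)).
rewrite subrKA (normFB_sym X); lra.
Qed.

Lemma Xt_sym : Xt^T = Xt.
Proof. by rewrite /Xt !trmx_mul trmxK tr_diag_mx mulmxA. Qed.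

(** The spectral norm of the inverse of [X] is controlled by that of the inverse
    of the Kronecker sum of [Xt]. *)
Lemma cond_le_kron_inv : L <= 17 / 8 * norm2 (invmx (kron_sum Xt)).
Proof.
have L0 : 0 < L by exact: (sqrt_inv_gt0 n0 X_sqrt).
have pX := init_perturbation; set h := norm2 _.
have h0 : 0 <= h by exact: norm2_ge0.
have dX : opbound (Xt - X) (L^-1 / 16).
  apply: opbound_le (@opbound_normF _ _ _ _) _; rewrite mulrC ler_pdivlMr //; lra.
have Xtc : coercive Xt (15 / 16 * L^-1).
  move=> x; have := coercive_sqrt n0 X_sqrt x; rewrite -/L.
  have := qform_le x dX; rewrite qformD qformN => /ler_normlP[+ _].
  have := sqr_ge0 (normF x); move: (normF x ^+ 2) (L^-1) => y l y0; lra.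
have Bu : kron_sum Xt \in unitmx.
  apply: kron_sum_unit Xtc; first exact: Xt_sym.
  by rewrite mulr_gt0 ?invr_gt0 //; lra.
apply: norm2_le => [|x]; first by rewrite mulr_ge0 //; lra.
set y := invmx X *m x.
have Xy : X *m y = x by rewrite mulKVmx // (sqrt_unit X_sqrt).
have yx : normF y <= L * normF x by exact: norm2_opbound.
have := kron_sum_inv_bound y Xt_sym Bu; rewrite -/h => /le_trans; apply.
have XtyE : normF (Xt *m y) <= 17 / 16 * normF x.
  have -> : Xt *m y = (Xt - X) *m y + x by rewrite mulmxBl Xy subrK.
  apply: le_trans (ler_normFD _ _) _; apply: le_trans (lerD (dX y) (lexx _)) _.
  have : L^-1 / 16 * normF y <= L^-1 / 16 * (L * normF x).
    by rewrite ler_wpM2l // divr_ge0 ?invr_ge0 ?(ltW L0).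
  have -> : L^-1 / 16 * (L * normF x) = normF x / 16 by field; lra.
  lra.
have -> : 17 / 8 * h * normF x = 2 * h * (17 / 16 * normF x) by field.
by rewrite ler_wpM2l // mulr_ge0.
Qed.

End ComputedFactors.

(** * The exact correction *)

Section Step.
Variable R : realType.

(** Replacing the Gram matrix [Q^T Q] by the identity in [J S J Z J] costs three
    terms, each containing one factor [g]. *)
Lemma sandwich_err n (Q S Z : 'M[R]_n) g b : near_orth Q g -> g <= 1 / 52 ->
  0 <= b -> opbound S b ->
  normF (Q^T *m Q *m S *m (Q^T *m Q) *m Z *m (Q^T *m Q) - S *m Z)
    <= 31 / 10 * (g * b) * normF Z.
Proof.
move=> [g0 g1 G] gl b0 Sb.
have Jsym : (Q^T *m Q)^T = Q^T *m Q by rewrite trmx_mul trmxK.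
move: (Q^T *m Q) G Jsym => J G Jsym.
set G' := J - 1%:M in G.
have J1 : J = G' + 1%:M by rewrite subrK.
have Gsym : G'^T = G' by rewrite /G' linearB /= trmx1 Jsym.
have GTg : opbound G'^T g by rewrite Gsym.
have JE : J *m S *m J *m Z *m J - S *m Z =
    G' *m (S *m (J *m (Z *m J))) + (S *m (G' *m (Z *m J)) + S *m (Z *m G')).
  have Jl (V : 'M_n) : J *m V = G' *m V + V by rewrite J1 mulmxDl mul1mx.
  have Jr (V : 'M_n) : V *m J = V *m G' + V by rewrite J1 mulmxDr mulmx1.
  rewrite -!mulmxA (Jl (S *m _)) -addrA; congr (_ + _).
  by rewrite Jl mulmxDr -addrA; congr (_ + _); rewrite Jr mulmxDr addrK.
have Jg : opbound J (1 + g).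
  move=> x; rewrite J1 mulmxDl mul1mx; apply: le_trans (ler_normFD _ _) _.
  by have := G x; lra.
have JTg : opbound J^T (1 + g) by rewrite Jsym.
have g1' : 0 <= 1 + g by lra.
have z0 := normF_ge0 Z; set z := normF Z in z0 *.
have gb0 : 0 <= g * b by exact: mulr_ge0.
have ZJ : normF (Z *m J) <= (1 + g) * z by exact: normF_mulr.
have JZJ : normF (J *m (Z *m J)) <= (1 + g) * ((1 + g) * z).
  by apply: le_trans (normF_mull _ g1' Jg) _; rewrite ler_wpM2l.
have h1 : normF (G' *m (S *m (J *m (Z *m J)))) <= g * b * ((1 + g) * ((1 + g) * z)).
  apply: le_trans (normF_mull _ g0 G) _; rewrite -mulrA ler_wpM2l //.
  by apply: le_trans (normF_mull _ b0 Sb) _; rewrite ler_wpM2l.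
have h2 : normF (S *m (G' *m (Z *m J))) <= g * b * ((1 + g) * z).
  apply: le_trans (normF_mull _ b0 Sb) _; rewrite (mulrC g) -mulrA ler_wpM2l //.
  by apply: le_trans (normF_mull _ g0 G) _; rewrite ler_wpM2l.
have h3 : normF (S *m (Z *m G')) <= g * b * z.
  apply: le_trans (normF_mull _ b0 Sb) _; rewrite (mulrC g) -mulrA ler_wpM2l //.
  exact: normF_mulr.
rewrite JE; apply: le_trans (ler_normFD _ _) _.
apply: le_trans (lerD h1 (le_trans (ler_normFD _ _) (lerD h2 h3))) _.
have -> : g * b * ((1 + g) * ((1 + g) * z)) + (g * b * ((1 + g) * z) + g * b * z) =
  ((1 + g) * (1 + g) + (1 + g) + 1) * (g * b) * z by ring.
rewrite ler_wpM2r // ler_wpM2r //.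
have : (1 + g) * (1 + g) <= 53 / 52 * (53 / 52) by apply: ler_pM; lra.
lra.
Qed.

(** The exact correction is Newton's: it reproduces [X - Y] up to a small linear
    part and a quadratic one.  The largest entry of [s] is only controlled through
    its product with [g], which keeps the condition number of [X] out of the
    linear part. *)
Lemma exact_correction_err n (A X Q Y : 'M[R]_n) (s : 'rV[R]_n) g b L :
  near_orth Q g -> g <= 1 / 52 -> 0 < L -> X *m X = A ->
  (forall i, 24 / 25 * L^-1 <= s 0 i) ->
  0 <= b -> opbound (diag_mx s) b -> g * b * L <= 1 / 50 ->
  normF (Q *m diag_mx s *m Q^T - X) * L <= 1 / 16 ->
  normF (X - Y - correction Q s (A - Y *m Y)) * L <=
    27 / 200 * (normF (X - Y) * L) + 11 / 20 * (normF (X - Y) * L) ^+ 2.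
Proof.
move=> Qg gl L0 XX sm b0 Sb gbL; set S := diag_mx s; set Xt := Q *m S *m Q^T.
move=> dX; have [g0 g1 G] := Qg; set J := Q^T *m Q in G.
have Qu := near_orth_unit Qg; have QTu : Q^T \in unitmx by rewrite unitmx_tr.
set e := X - Y; pose f := invmx Q *m e *m invmx Q^T.
have eE : e = Q *m f *m Q^T by rewrite /f !mulmxA mulmxV // mul1mx mulmxKV.
have s0 i : 0 < s 0 i.
  by apply: lt_le_trans (sm i); rewrite mulr_gt0 ?invr_gt0 //; lra.
set D := X - Xt; have nD : normF D * L <= 1 / 16 by rewrite normFB_sym.
(* the exact residual, centred at Xt rather than at X *)
have resE : A - Y *m Y = (Xt *m e + e *m Xt) + (D *m e + e *m D) - e *m e.
  have zmod (V : zmodType) (a1 a2 a3 a4 : V) :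
      a1 - (a1 - a2 - (a3 - a4)) = a2 + a3 - a4.
    by rewrite opprB (opprB a1) addrCA subrKC addrC addrA.
  have gen (D' e' : 'M_n) : X *m X - (X - e') *m (X - e') =
      ((X - D') *m e' + e' *m (X - D')) + (D' *m e' + e' *m D') - e' *m e'.
    by rewrite !mulmxBl !mulmxBr zmod addrACA !subrK.
  by have := gen D e; rewrite !subKr XX.
pose W := S *m f + f *m S - Q^T *m (A - Y *m Y) *m Q.
have eW : e - correction Q s (A - Y *m Y) = Q *m sylv s W *m Q^T.
  by rewrite /W sylvB sylvK // mulmxBr mulmxBl -eE.
pose U := J *m S *m J *m f *m J - S *m f.
pose U' := J *m S *m J *m f^T *m J - S *m f^T.
have WE : W = - U - U'^T - Q^T *m (D *m e + e *m D - e *m e) *m Q.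
  have -> : U'^T = J *m f *m J *m S *m J - f *m S.
    by rewrite /U' /J linearB /= !trmx_mul !trmxK tr_diag_mx !mulmxA.
  rewrite /W; have -> : Q^T *m (A - Y *m Y) *m Q =
      J *m S *m J *m f *m J + J *m f *m J *m S *m J
      + Q^T *m (D *m e + e *m D - e *m e) *m Q.
    rewrite resE -addrA (mulmxDr Q^T (Xt *m e + e *m Xt)) (mulmxDl (Q^T *m _)).
    congr (_ + _).
    by rewrite /Xt /J {1 2}eE mulmxDr mulmxDl !mulmxA.
  rewrite /U !opprB opprD addrA; congr (_ - _).
  by rewrite opprD addrACA.
have nU := sandwich_err f Qg gl b0 Sb; have nU' := sandwich_err f^T Qg gl b0 Sb.
rewrite -/J -/U -/U' in nU nU'; rewrite normF_tr in nU'.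
have nf : 51 / 52 * normF f <= normF e.
  have := normF_congr_ge Qg f; rewrite -eE; apply: le_trans.
  by rewrite ler_wpM2r ?normF_ge0 //; lra.
have e0 := normF_ge0 e; have f0 := normF_ge0 f.
set ne := normF e in nf e0 *; set nf' := normF f in nU nU' nf f0 *.
have nV : normF (D *m e + e *m D - e *m e) <= 2 * (normF D * ne) + ne ^+ 2.
  apply: le_trans (ler_normFB _ _) _.
  apply: lerD; last by rewrite expr2; exact: normFM.
  apply: le_trans (ler_normFD _ _) _.
  have := normFM D e; have := normFM e D; rewrite -/ne; lra.
have nV' : normF (Q^T *m (D *m e + e *m D - e *m e) *m Q) <=
    53 / 52 * (2 * (normF D * ne) + ne ^+ 2).
  apply: le_trans (normF_congr_tr_le Qg _) _.
  by apply: ler_pM => //; [lra | exact: normF_ge0 | lra].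
have nW : normF W <= 2 * (31 / 10 * (g * b) * nf') +
    53 / 52 * (2 * (normF D * ne) + ne ^+ 2).
  rewrite WE; apply: le_trans (ler_normFB _ _) _; apply: lerD nV'.
  apply: le_trans (ler_normFB _ _) _; rewrite normFN normF_tr; lra.
have L20 : 0 <= L ^+ 2 by exact: sqr_ge0.
have nW2 : normF W * L ^+ 2 <= 2 * (31 / 10 * (1 / 50) * (52 / 51 * (ne * L)))
    + 53 / 52 * (2 * (1 / 16 * (ne * L)) + (ne * L) ^+ 2).
  apply: le_trans (ler_wpM2r L20 nW) _.
  have -> : (2 * (31 / 10 * (g * b) * nf') +
        53 / 52 * (2 * (normF D * ne) + ne ^+ 2)) * L ^+ 2
    = 2 * (31 / 10) * ((g * b * L) * (nf' * L)) +
        53 / 52 * (2 * ((normF D * L) * (ne * L)) + (ne * L) ^+ 2) by ring.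
  have eL : 0 <= ne * L by rewrite mulr_ge0 // ltW.
  have h1 : g * b * L * (nf' * L) <= 1 / 50 * (52 / 51 * (ne * L)).
    apply: ler_pM => //; first by rewrite !mulr_ge0 // ltW.
      by rewrite mulr_ge0 // ltW.
    by rewrite mulrA ler_wpM2r ?(ltW L0) //; lra.
  have h2 : normF D * L * (ne * L) <= 1 / 16 * (ne * L) by rewrite ler_wpM2r.
  lra.
have m0 : 0 < 24 / 25 * L^-1 by rewrite mulr_gt0 ?invr_gt0 //; lra.
have nZ : normF (e - correction Q s (A - Y *m Y)) <= 53 / 52 * (25 / 48 * L * normF W).
  rewrite eW; apply: le_trans (normF_congr_le Qg _) _.
  apply: ler_pM; [lra | exact: normF_ge0 | lra |].
  apply: le_trans (normF_sylv _ m0 sm) _; rewrite ler_wpM2r ?normF_ge0 //.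
  by apply: ler_eq; field; lra.
apply: le_trans (ler_wpM2r (ltW L0) nZ) _.
have -> : 53 / 52 * (25 / 48 * L * normF W) * L =
  53 / 52 * (25 / 48) * (normF W * L ^+ 2) by ring.
have := sqr_ge0 (ne * L); have : 0 <= ne * L by rewrite mulr_ge0 // ltW.
move: nW2; move: (ne * L) (normF W * L ^+ 2) => x y; lra.
Qed.

End Step.

(** * Convergence *)

Section Convergence.
Variable R : realType.

(** One step halves the error, up to the limiting accuracy.  Of the factor 4 in
    that accuracy, about [542/1000 * (13/12) * (17/8)], less than 5/4, is used. *)
Lemma refinement_contraction n (A X Q Y Y' : 'M[R]_n) (s : 'rV[R]_n)
    (u ul g b L h M : R) :
  let mu := gam ul (Num.sqrt n%:R * (4 * n + 3)%:R) in
  let N := normF X in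
  (0 < n)%N -> 0 <= u -> n.+1%:R * u < 1 -> 0 <= ul ->
  Num.sqrt n%:R * (4 * n + 3)%:R * ul < 1 ->
  near_orth Q g -> g <= 1 / 52 -> 0 < L -> X *m X = A -> normF A <= N ^+ 2 ->
  (forall i, 24 / 25 * L^-1 <= s 0 i) ->
  0 <= b -> opbound (diag_mx s) b -> g * b * L <= 1 / 50 ->
  normF (Q *m diag_mx s *m Q^T - X) * L <= 1 / 16 ->
  1 <= L * N -> mu * (L * N) <= 1 / 12 -> 0 <= h -> L <= 17 / 8 * h ->
  normF Y <= M * N -> normF Y' <= M * N ->
  refinement_step u ul A Q s Y Y' ->
  normF (X - Y) * L <= 3 / 8 ->
  normF (X - Y') * L <= 1 / 2 * (normF (X - Y) * L)
    + (4 * gam u n.+1%:R * (1 + M ^+ 2) * h * N + gam u 1 * M) * (N * L).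
Proof.
move=> mu N n0 u0 nu ul0 vul Qg gl L0 XX AN sm b0 Sb gbL dX LN muLN h0 Lh YM Y'M.
move=> [P [Rl [C [Z [DX [[resP PRl RC] [CZ ZDX upd]]]]]]] tau.
have [g0 g1 _] := Qg.
have g2 : (1 + g) ^+ 2 <= (53 / 52) ^+ 2.
  by rewrite ler_pXn2r ?nnegrE //; move: g0 gl; clear; lra.
have m0 : 0 < 24 / 25 * L^-1 by rewrite mulr_gt0 ?invr_gt0 // divr_gt0.
have eZ := exact_correction_err Y Qg gl L0 XX sm b0 Sb gbL dX.
have eP := residual_err n0 u0 nu resP.
have v1 := sqrtn_ge1 R n0; set v := Num.sqrt n%:R in v1 vul mu muLN *.
have v0 : 0 <= v by exact: le_trans ler01 v1.
have c0 : 0 <= v * (4 * n + 3)%:R by rewrite mulr_ge0.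
have c1 : 1 <= v * (4 * n + 3)%:R.
  have c2 : 1 <= (4 * n + 3)%:R :> R by rewrite ler1n addnS.
  by rewrite -[leLHS]mul1r ler_pM.
have mu0 : 0 <= mu by exact: gam_ge0.
have ul1 : ul < 1.
  by apply: le_lt_trans vul; rewrite ler_peMl.
have u1 : u < 1.
  by apply: le_lt_trans nu; rewrite ler_peMl // ler1n.
have q0 : 0 <= Num.sqrt (1 + g) by exact: sqrtr_ge0.
have Qq := near_orth_opbound Qg; have QTq := near_orth_opbound_tr Qg.
have q2 := near_orth_q Qg; set q := Num.sqrt (1 + g) in q0 Qq QTq q2.
have Qr : normF Q <= v * q by exact: normF_le_sqrtn.
have eD := correction_err n0 ul0 ul1 q0 v0 Qq QTq Qr m0 sm PRl RC CZ ZDX.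
have upde := fl_mx_err_computed u0 u1 upd.
set P0 := A - Y *m Y in eZ eP; set F := P - P0 in eP.
have PE : P = P0 + F by rewrite addrC subrK.
have nF := normF_correction F q0 Qq QTq m0 sm.
have q4 : q ^+ 4 = (1 + g) ^+ 2 by rewrite -q2; ring.
have phiE : q ^+ 4 * (2 * (24 / 25 * L^-1))^-1 = 25 / 48 * (1 + g) ^+ 2 * L.
  by rewrite q4; field; rewrite gt_eqF.
rewrite phiE in eD nF.
set e := X - Y in eZ tau *; set ne := normF e in eZ tau *.
have ne0 : 0 <= ne by exact: normF_ge0.
have nP0 : normF P0 <= 2 * (N * ne) + ne ^+ 2.
  have -> : P0 = X *m e + e *m X - e *m e.
    have gen (e' : 'M_n) : X *m X - (X - e') *m (X - e') = X *m e' + e' *m X - e' *m e'.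
      rewrite !mulmxBl !mulmxBr opprB (opprB (X *m X)) addrCA subrKC.
      by rewrite addrC addrA.
    by have := gen e; rewrite subKr XX.
  apply: le_trans (ler_normFB _ _) _.
  apply: lerD; last by rewrite expr2; exact: normFM.
  apply: le_trans (ler_normFD _ _) _; rewrite mulr_natl mulr2n.
  by apply: lerD; [|rewrite mulrC]; exact: normFM.
set G := gam u n.+1%:R in eP *; have G0 : 0 <= G by exact: gam_ge0.
have N0 : 0 <= N by exact: normF_ge0.
have G1 : 0 <= gam u 1 by apply: gam_ge0; rewrite ?mul1r.
have nFN : normF F <= G * (1 + M ^+ 2) * N ^+ 2.
  apply: le_trans eP _; rewrite -mulrA ler_wpM2l // mulrDl mul1r -exprMn.
  apply: lerD => //; rewrite ler_sqr ?nnegrE ?normF_ge0 //.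
  exact: le_trans (normF_ge0 _) YM.
set f := G * (1 + M ^+ 2) * N ^+ 2 in nFN.
have f0 : 0 <= f by exact: le_trans (normF_ge0 _) nFN.
have nP : normF P <= 2 * (N * ne) + ne ^+ 2 + f.
  by rewrite PE; apply: le_trans (ler_normFD _ _) _; exact: lerD.
have fac := low_precision_factor n0 ul0 vul; rewrite -/v -/mu in fac.
have phi0 : 0 <= 25 / 48 * (1 + g) ^+ 2 * L.
  apply: mulr_ge0; last exact: ltW.
  by apply: mulr_ge0; [rewrite divr_ge0 | exact: sqr_ge0].
have phi1 : 25 / 48 * (1 + g) ^+ 2 * L <= 542 / 1000 * L.
  by rewrite ler_wpM2r ?(ltW L0) //; move: g2; clear; lra.
have eD' : normF (DX - correction Q s P) <=
    mu * (542 / 1000 * L * (2 * (N * ne) + ne ^+ 2 + f)).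
  apply: le_trans eD _.
  apply: (@le_trans _ _ (mu * (25 / 48 * (1 + g) ^+ 2 * L * normF P))).
    by apply: ler_wpM2r; [rewrite mulr_ge0 ?normF_ge0 | rewrite lerBlDl].
  by rewrite ler_wpM2l // ler_pM // normF_ge0.
have nF' : normF (correction Q s F) <= 542 / 1000 * L * f.
  by apply: le_trans nF _; apply: ler_pM => //; exact: normF_ge0.
have upde' : normF (Y' - (Y + DX)) <= gam u 1 * (M * N).
  by apply: le_trans upde _; rewrite ler_wpM2l.
have eE : X - Y' = (e - correction Q s P0) - correction Q s F
    - (DX - correction Q s P) - (Y' - (Y + DX)).
  rewrite PE correctionD /e; move: (correction Q s P0) (correction Q s F) => a1 a2.
  by apply/matrixP => i j; rewrite !mxE; ring.
have E1 : normF (X - Y') <= normF (e - correction Q s P0) + 542 / 1000 * L * f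
   + mu * (542 / 1000 * L * (2 * (N * ne) + ne ^+ 2 + f)) + gam u 1 * (M * N).
  by rewrite eE; do 3![apply: le_trans (ler_normFB _ _) _; apply: lerD => //].
have mu1 : mu <= 1 / 12.
  by apply: le_trans muLN; rewrite ler_peMr.
have fL : f * L ^+ 2 <= G * (1 + M ^+ 2) * N * (17 / 8 * h) * (N * L).
  have -> : f * L ^+ 2 = G * (1 + M ^+ 2) * N * L * (N * L) by rewrite /f; ring.
  rewrite ler_wpM2r ?mulr_ge0 ?(ltW L0) // ler_wpM2l //.
  by apply: mulr_ge0 => //; apply: mulr_ge0 => //; rewrite addr_ge0 ?sqr_ge0.
have fL0 : 0 <= f * L ^+ 2 by rewrite mulr_ge0 ?sqr_ge0.
set x := ne * L in eZ tau *; have x0 : 0 <= x by rewrite mulr_ge0 ?(ltW L0).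
apply: le_trans (ler_wpM2r (ltW L0) E1) _.
have -> : (normF (e - correction Q s P0) + 542 / 1000 * L * f
   + mu * (542 / 1000 * L * (2 * (N * ne) + ne ^+ 2 + f)) + gam u 1 * (M * N)) * L
   = normF (e - correction Q s P0) * L + 542 / 1000 * (f * L ^+ 2)
   + 542 / 1000 * (2 * (mu * (L * N) * x) + mu * x ^+ 2 + mu * (f * L ^+ 2))
   + gam u 1 * M * (N * L).
  by rewrite /x; ring.
have -> : (4 * G * (1 + M ^+ 2) * h * N + gam u 1 * M) * (N * L)
   = 4 * (8 / 17) * (G * (1 + M ^+ 2) * N * (17 / 8 * h) * (N * L))
     + gam u 1 * M * (N * L).
  by field.
have k1 : mu * (L * N) * x <= 1 / 12 * x by rewrite ler_wpM2r.
have k2 : mu * x ^+ 2 <= 1 / 12 * x ^+ 2 by rewrite ler_wpM2r ?sqr_ge0.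
have k3 : mu * (f * L ^+ 2) <= 1 / 12 * (f * L ^+ 2) by rewrite ler_wpM2r.
have k4 : x ^+ 2 <= 3 / 8 * x by rewrite expr2 ler_wpM2r.
move: eZ fL fL0 k1 k2 k3 k4.
move: (normF (e - _) * L) (f * L ^+ 2) (mu * (L * N) * x) (mu * x ^+ 2)
  (x ^+ 2) => y1 y2 y3 y4 y5.
move: (mu * y2) (G * _ * _ * _ * _) (gam u 1 * M * (N * L)) => y6 y7 y8.
by rewrite -/x; move: x0; clear; lra.
Qed.
Lemma contraction_iterates (tau : nat -> R) (x : R) :
  0 <= x -> x < 3 / 32 -> tau 0%N <= 3 / 8 ->
  (forall k, tau k <= 3 / 8 -> tau k.+1 <= 1 / 2 * tau k + x) ->
  forall k, tau k <= 2 * x + 3 / 8 * (1 / 2) ^+ k.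
Proof.
move=> x0 x_small tau0 step k.
suff [] : tau k <= 3 / 8 /\ tau k <= 2 * x + 3 / 8 * (1 / 2) ^+ k by [].
elim: k => [|k [IH1 IH2]]; first by split=> //; rewrite expr0; lra.
by have := step k IH1; rewrite exprS; split; lra.
Qed.

End Convergence.

Theorem theorem3p7 (R : realType) (n : nat) (u ul c : R)
    (A X Q : 'M[R]_n) (t s : 'rV[R]_n) (Xk : nat -> 'M[R]_n)
    (n_gt0 : (0 < n)%N) (u_gt0 : 0 < u) (ul_gt0 : 0 < ul) (c_gt0 : 0 < c)
    (gam_def : n.+1%:R * u < 1)
    (gaml_def : Num.sqrt n%:R * (4 * n + 3)%:R * ul < 1)
    (gam_eig_def : c * n%:R ^+ 2 * ul < 1)
    (A_spd : spd A) (X_sqrt : principal_sqrt A X)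
    (run : mixed_precision_run u ul (gam_eig ul c n) A Q t s Xk)
    (Xk_bounded : has_ubound (range (fun k => normF (Xk k) / normF X))%classic) :
  let Xt := Q *m diag_mx s *m Q^T in
  let M := iterate_bound X Xk in
  let eps := limiting_accuracy u M X Xt in
  let epsl := eps_low ul c Xt in
  Num.sqrt n%:R * gam_eig ul c n * norm2 (invmx A) * normF A <= 1 / 52 ->
  epsl * norm2 (invmx X) * normF X <= 1 / 12 ->
  eps * norm2 (invmx X) * normF X < 3 / 32 ->
  exists alpha rho : R,
    [/\ 0 <= alpha, 0 <= rho, rho < 1 &
        forall k, normF (X - Xk k) / normF X <= 4 * eps + alpha * rho ^+ k].
Proof.
move=> Xt M eps epsl g_small epsl_small eps_small.
have [[QG [E [_ EgA AE]]] s_sqrt X0_prod steps] := run.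
set g := gam_eig ul c n in g_small QG EgA.
have u0 := ltW u_gt0; have ul0 := ltW ul_gt0.
have g0 : 0 < g.
  have n2 : 0 < n%:R ^+ 2 :> R by rewrite exprn_gt0 // ltr0n.
  by apply: divr_gt0; [do 2![apply: mulr_gt0 => //] | rewrite subr_gt0].
have gl := g_le n_gt0 X_sqrt (ltW g0) g_small.
have Qg : near_orth Q g.
  split; [exact: ltW | by lra | exact: opbound_le (@norm2_opbound _ _ _ _) QG].
have Eb : opbound E (g * norm2 A) by exact: opbound_le (@norm2_opbound _ _ _ _) EgA.
set L := norm2 (invmx X) in epsl_small eps_small *.
set N := normF X in epsl_small eps_small *.
have L0 : 0 < L := sqrt_inv_gt0 n_gt0 X_sqrt.
have LN : 1 <= L * N := ge1_cond_sqrt n_gt0 X_sqrt.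
have LN0 : 0 < L * N by lra.
have N0 : 0 < N by rewrite -(pmulr_rgt0 _ L0).
set v := Num.sqrt n%:R in gaml_def g_small.
have v1 : 1 <= v := sqrtn_ge1 R n_gt0.
pose mu := gam ul (v * (4 * n + 3)%:R).
(* The spectral error term of epsl is nonnegative and is dropped. *)
have mu_small : mu * (L * N) <= 1 / 12.
  apply: le_trans epsl_small; rewrite -mulrA ler_wpM2r ?(ltW LN0) //.
  rewrite /epsl /eps_low -/v -/mu lerDl.
  apply: mulr_ge0; first by rewrite mulr_ge0 // ltW.
  by rewrite /kappa2 mulr_ge0 ?norm2_ge0.
(* 7 is the value of sqrt n * (4 n + 3) at n = 1. *)
have mu_ul : 7 * ul <= mu.
  have n7 : 7 <= (4 * n + 3)%:R :> R.
    by rewrite ler_nat (leq_add (leq_mul (leqnn 4) n_gt0) (leqnn 3)).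
  apply: le_trans (le_gam ul0 _ gaml_def); last by rewrite mulr_ge0 //; lra.
  by rewrite ler_wpM2r // -[leLHS]mul1r ler_pM.
have ul_small : ul * (L * N) <= 1 / 84.
  have := ler_wpM2r (ltW LN0) mu_ul; lra.
have sm := s_lower n_gt0 X_sqrt (ltW g0) Qg AE Eb g_small ul0 ul_small s_sqrt.
have gs := gs_upper n_gt0 X_sqrt (ltW g0) Qg AE Eb g_small ul0 ul_small s_sqrt.
have dXt := init_perturbation n_gt0 X_sqrt (ltW g0) Qg AE Eb g_small ul0 ul_small s_sqrt.
have Lh := cond_le_kron_inv n_gt0 X_sqrt (ltW g0) Qg AE Eb g_small ul0 ul_small s_sqrt.
rewrite -/L -/N -/Xt in sm gs dXt Lh.
set h := norm2 (invmx (kron_sum Xt)) in Lh.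
have h0 : 0 <= h by exact: norm2_ge0.
have Xk_le k : normF (Xk k) <= M * N.
  by rewrite -ler_pdivrMr //; apply: ub_le_sup => //; exists k.
have M0 : 0 <= M.
  by rewrite -(pmulr_lge0 _ N0); exact: le_trans (normF_ge0 _) (Xk_le 0%N).
(* The largest bound on the entries of s that gs_upper allows. *)
pose b := (50 * g * L)^-1.
have b0 : 0 <= b by rewrite invr_ge0; do 2?apply: mulr_ge0 => //; exact: ltW.
have gbL : g * b * L <= 1 / 50.
  by apply: ler_eq; rewrite /b; field; rewrite !gt_eqF.
have Sb : opbound (diag_mx s) b.
  apply: opbound_diag => // i; have si := sm i.
  have Li : 0 < L^-1 by rewrite invr_gt0.
  rewrite ger0_norm; last by lra.
  have gL : 0 < g * L by rewrite mulr_gt0.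
  by rewrite -(ler_pM2l gL) mulrAC; apply: le_trans (gs i) _;
     apply: ler_eq; rewrite /b; field; rewrite !gt_eqF.
have XX : X *m X = A by case: X_sqrt.
pose x := eps * (N * L).
have eps0 : 0 <= eps.
  have G0 : 0 <= gam u n.+1%:R by exact: gam_ge0.
  have u1 : u < 1 by apply: le_lt_trans gam_def; rewrite ler_peMl // ler1n.
  have G1 : 0 <= gam u 1 by apply: gam_ge0; rewrite ?mul1r.
  have N0' := ltW N0; have M1 : 0 <= 1 + M ^+ 2 by rewrite addr_ge0 ?sqr_ge0.
  apply: addr_ge0; last exact: mulr_ge0.
  by do 4?apply: mulr_ge0 => //.
have x0 : 0 <= x by rewrite mulr_ge0 // mulr_ge0 // ltW.
have x_small : x < 3 / 32 by rewrite /x (mulrC N) mulrA.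
have step k : normF (X - Xk k) * L <= 3 / 8 ->
    normF (X - Xk k.+1) * L <= 1 / 2 * (normF (X - Xk k) * L) + x.
  move=> tau; rewrite /x /eps /limiting_accuracy -/h.
  exact: (refinement_contraction n_gt0 u0 gam_def ul0 gaml_def Qg gl L0 XX
    (normF_of_sqrt X_sqrt) sm b0 Sb gbL dXt LN mu_small h0 Lh (Xk_le k)
    (Xk_le k.+1) (steps k) tau).
have start : normF (X - Xk 0%N) * L <= 3 / 8.
  exact: (initial_iterate_err n_gt0 X_sqrt (ltW g0) Qg AE Eb g_small ul0 ul_small
    s_sqrt gaml_def mu_small X0_prod).
have err := contraction_iterates x0 x_small start step.
exists (3 / 8 / (L * N)), (1 / 2).
split; [by rewrite divr_ge0 ?(ltW LN0) // divr_ge0 | by rewrite divr_ge0 | |].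
  by clear; lra.
move=> k; rewrite ler_pdivrMr // -(ler_pM2r L0); apply: le_trans (err k) _.
have -> : (4 * eps + 3 / 8 / (L * N) * (1 / 2) ^+ k) * N * L =
    4 * x + 3 / 8 * (1 / 2) ^+ k by rewrite /x; field; rewrite !gt_eqF.
by move: x0; clear; lra.
Qed.
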